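(* Let $q$ be a 2way-determined two-atom query over $R$ satisfying the standing assumption below which admits a triangle-tripath. Then for every $k\ge1$, $\mathrm{certain}(q)\neq\mathrm{Cert}_k(q)$, i.e. the set of databases $D$ with $\emptyset\in\Delta_k(q,D)$ differs from the set of databases for which $q$ is certain.
   Context: $R$ has arity at least $1$ with first $l$ positions forming the key. Facts $R(\bar a)$, atoms $R(\bar x)$; $\mathrm{vars}(A)$ variables of $A$; $\overline{\mathrm{key}}(t)$ tuple of first $l$ entries, $\mathrm{key}(t)$ their set; $a\sim b$ iff equal key tuples. Database: finite set of facts; block: maximal set of pairwise key-equal facts; repair: $\subseteq$-maximal subset with no two distinct key-equal facts. For a set of facts $S$, $S\models q(ab)$ means $a=\mu(A)$, $b=\mu(B)\in S$ for some mapping $\mu$; $q\{ab\}$ means $q(ab)$ or $q(ba)$; $S$ satisfies $q$ if some such pair exists; $q$ is certain for $D$ if every repair satisfies $q$. $q=AB$ is 2way-determined if $\mathrm{key}(A)\not\subseteq\mathrm{key}(B)$, $\mathrm{key}(B)\not\subseteq\mathrm{key}(A)$, $\mathrm{key}(A)\subseteq\mathrm{vars}(B)$, $\mathrm{key}(B)\subseteq\mathrm{vars}(A)$. Standing assumption: $\overline{\mathrm{key}}(A)\ne\overline{\mathrm{key}}(B)$ and $q$ not equivalent over consistent databases to a single-atom query. Greedy fixpoint: a $k$-set of $D$ is $S\subseteq D$, $|S|\le k$, at most one fact per block; $\Delta_k(q,D)$ is the least set of $k$-sets containing all $k$-sets satisfying $q$ and containing a $k$-set $S$ whenever some block $B$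 of $D$ satisfies: for every $u\in B$ some $S'\subseteq S\cup\{u\}$ is in $\Delta_k(q,D)$. $\mathrm{Cert}_k(q)$ accepts $D$ iff $\emptyset\in\Delta_k(q,D)$. $g(e)$: for facts $d,e,f$ with $q(de),q(ef)$, $\bar g(e)$ is $\overline{\mathrm{key}}(d)$ if $\mathrm{key}(d)\subseteq\mathrm{key}(e)$, $\mathrm{key}(f)\not\subseteq\mathrm{key}(e)$; $\overline{\mathrm{key}}(f)$ if $\mathrm{key}(d)\not\subseteq\mathrm{key}(e)$, $\mathrm{key}(f)\subseteq\mathrm{key}(e)$; $\overline{\mathrm{key}}(d)$ if $\mathrm{key}(d)\subseteq\mathrm{key}(f)\subseteq\mathrm{key}(e)$; $\overline{\mathrm{key}}(f)$ if $\mathrm{key}(f)\subseteq\mathrm{key}(d)\subseteq\mathrm{key}(e)$; else $\overline{\mathrm{key}}(e)$; $g(e)$ its element set. A tripath is a database $\Theta$ with blocks of size at most two arranged as a rooted tree (parent $s$) with exactly two leaves: root $B_0$ has exactly one fact $a(B_0)$, each leaf $B$ exactly one fact $b(B)$, others exactly two facts $a(B),b(B)$; if $B=s(B')$ then $\Theta\models q\{a(B)b(B')\}$; for the unique block $B$ with two children $B',B''$, with $e=a(B)$, $d=b(B')$, $f=b(B'')$ (suitably ordered), $\Theta\models q(de)$, $\Theta\models q(ef)$; with $u_0=a(B_0)$, $u_1,u_2$ the leaf facts, $g(e)\not\subseteq\mathrm{key}(u_i)$, $i=0,1,2$. It is a triangle-tripath if moreover $\Theta\models q(fd)$. $q$ admits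 a triangle-tripath if some database contains one as a subset. *)

(* Defs.v *)
(* Single relation R of arity n, key = first l positions.
   Constants and variables are both represented by nat (separate roles:
   facts are tuples of constants, atoms are tuples of variables). *)
From mathcomp Require Import all_boot.
Set Implicit Arguments. Unset Strict Implicit. Unset Printing Implicit Defensive.

Definition keyt (n l : nat) (t : n.-tuple nat) : seq nat := take l t.
Definition key_eq (n l : nat) (a b : n.-tuple nat) : bool := keyt l a == keyt l b.
Definition ksub (s1 s2 : seq nat) : bool := all (fun x => x \in s2) s1.

(* databases: finite sets of facts, represented by sequences (set semantics) *)
Definition subdb (n : nat) (S T : seq (n.-tuple nat)) : Prop := {subset S <= T}.

Definition qmatch (n : nat) (A B a b : n.-tuple nat) : Prop :=
  exists mu : nat -> nat, tval a = map mu (tval A) /\ tval b = map mu (tval B).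
Definition sat_ab (n : nat) (A B : n.-tuple nat) (S : seq (n.-tuple nat)) (a b : n.-tuple nat) : Prop :=
  a \in S /\ b \in S /\ qmatch A B a b.
Definition sat_sym (n : nat) (A B : n.-tuple nat) (S : seq (n.-tuple nat)) (a b : n.-tuple nat) : Prop :=
  sat_ab A B S a b \/ sat_ab A B S b a.
Definition satisfies (n : nat) (A B : n.-tuple nat) (S : seq (n.-tuple nat)) : Prop :=
  exists a b, sat_ab A B S a b.
Definition sat_atom (n : nat) (C : n.-tuple nat) (S : seq (n.-tuple nat)) : Prop :=
  exists (mu : nat -> nat) (a : n.-tuple nat), a \in S /\ tval a = map mu (tval C).

Definition consistent (n l : nat) (S : seq (n.-tuple nat)) : Prop :=
  forall a b, a \in S -> b \in S -> key_eq l a b -> a = b.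

Definition is_repair (n l : nat) (D r : seq (n.-tuple nat)) : Prop :=
  subdb r D /\ consistent l r /\
  (forall r' : seq (n.-tuple nat), subdb r r' -> subdb r' D -> consistent l r' -> subdb r' r).

Definition certain (n l : nat) (A B : n.-tuple nat) (D : seq (n.-tuple nat)) : Prop :=
  forall r, is_repair l D r -> satisfies A B r.

Definition kset (n l k : nat) (D S : seq (n.-tuple nat)) : Prop :=
  subdb S D /\ size (undup S) <= k /\ consistent l S.

(* Delta_k(q,D), as the least set closed under the two rules.  A block of D
   is given by a representative fact f in D: it is the set of u in D with u ~ f. *)
Inductive Delta (n l : nat) (A B : n.-tuple nat) (k : nat) (D : seq (n.-tuple nat))
  : seq (n.-tuple nat) -> Prop :=
| Delta_sat S : kset l k D S -> satisfies A B S -> Delta l A B k D S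
| Delta_block S (f : n.-tuple nat) : kset l k D S -> f \in D ->
    (forall u, u \in D -> key_eq l u f ->
       exists S', subdb S' (u :: S) /\ Delta l A B k D S') ->
    Delta l A B k D S.

Definition Cert (n l : nat) (A B : n.-tuple nat) (k : nat) (D : seq (n.-tuple nat)) : Prop :=
  Delta l A B k D [::].

Definition twoway (n l : nat) (A B : n.-tuple nat) : Prop :=
  ~~ ksub (keyt l A) (keyt l B) /\ ~~ ksub (keyt l B) (keyt l A) /\
  ksub (keyt l A) (tval B) /\ ksub (keyt l B) (tval A).

Definition standing (n l : nat) (A B : n.-tuple nat) : Prop :=
  keyt l A <> keyt l B /\
  ~ (exists C : n.-tuple nat, forall D : seq (n.-tuple nat),
        consistent l D -> (satisfies A B D <-> sat_atom C D)).

Definition gbar (n l : nat) (d e f : n.-tuple nat) : seq nat :=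
  let kd := keyt l d in let ke := keyt l e in let kf := keyt l f in
  if ksub kd ke && ~~ ksub kf ke then kd
  else if ~~ ksub kd ke && ksub kf ke then kf
  else if ksub kd kf && ksub kf ke then kd
  else if ksub kf kd && ksub kd ke then kf
  else ke.

(* Tripath (triangle-tripath if [triangle] is true).  Blocks of T are
   identified by their key tuples; [s] is the parent function (meaningful on
   non-root blocks), [a], [b] name the facts of each block. *)
Definition tripath (n l : nat) (A B : n.-tuple nat) (T : seq (n.-tuple nat))
  (triangle : bool) : Prop :=
  exists (root : seq nat) (s : seq nat -> seq nat) (a b : seq nat -> n.-tuple nat)
         (lf1 lf2 : seq nat),
  let K := [seq keyt l t | t <- T] in
  let child k' k := k' \in K /\ k' <> root /\ s k' = k in
  let leaf k := k \in K /\ forall k', ~ child k' k in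
  root \in K /\
      (forall k, k \in K -> k <> root -> s k \in K) /\
      (forall k, k \in K -> exists m, iter m s k = root) /\
      (leaf lf1 /\ leaf lf2 /\ lf1 <> lf2 /\ forall k, leaf k -> k = lf1 \/ k = lf2) /\
      (forall t, (t \in T /\ keyt l t = root) <-> t = a root) /\
      (forall k, k \in K -> k <> root -> leaf k ->
         forall t, (t \in T /\ keyt l t = k) <-> t = b k) /\
      (forall k, k \in K -> k <> root -> ~ leaf k ->
         a k <> b k /\ forall t, (t \in T /\ keyt l t = k) <-> (t = a k \/ t = b k)) /\
      (forall k k', child k' k -> sat_sym A B T (a k) (b k')) /\
      exists k k1 k2, child k1 k /\ child k2 k /\ k1 <> k2 /\
        sat_ab A B T (b k1) (a k) /\ sat_ab A B T (a k) (b k2) /\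
        (triangle -> sat_ab A B T (b k2) (b k1)) /\
        forall u, u \in [:: a root; b lf1; b lf2] ->
          ~~ ksub (gbar l (b k1) (a k) (b k2)) (keyt l u).

Definition admits_triangle_tripath (n l : nat) (A B : n.-tuple nat) : Prop :=
  exists D T : seq (n.-tuple nat), subdb T D /\ tripath l A B T true.

(* Main.v *)
Require Import Defs.
From mathcomp Require Import all_boot.
From mathcomp Require Import zify.
From Stdlib Require Import Classical.

(** For a fact [e] of the triangle, a "leg" is a path of blocks from that of [e]
    outwards whose consecutive blocks are linked by a solution, so that choosing a
    fact at the far end forces the choice of [e].  A hub is a triangle with three
    legs: at most one leg of a hub can serve the "connector" block at its end.  Hubs
    and connectors are arranged as in the pigeonhole principle, the constraint "at
    most one pigeon in a hole" being spread over a chain of hubs; there are more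
    connectors than hubs, hence [q] is certain, but [N + 1] pigeons and [N] holes
    look consistent to [Cert_k] when [k < N].

    For this no solution may occur in the database besides the intended ones, and
    distinct connectors need distinct keys.  Replacing the triangle by its product
    with its two rotations, its keys are either pairwise incomparable, and one link
    is a leg, or have all the same elements, and the tripath provides a path along
    which one of these elements is lost.  A linear algebra argument over [Z/2]
    straightens this path into one which follows the links [A -> B] only; then
    each of its links [K -> K'] is replaced by [K -> U <- D -> K'] where [U] and [D]
    contain fresh elements, which excludes all unintended solutions. *)

Set Implicit Arguments. Unset Strict Implicit. Unset Printing Implicit Defensive.

(** * Solutions and keys *)

Lemma periodic3 (E : Type) (f : nat -> E) s : (forall t, f t.+3 = f t) -> f (s %% 3) = f s.
Proof.
move=> f3; rewrite {2}(divn_eq s 3); elim: (s %/ 3) => [|q IH]; first by rewrite add0n.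
by rewrite mulSn -addnA [3 + _]addnC addn3 f3.
Qed.

Section Matching.
Variables (n l : nat).
Implicit Types (A B x z : n.-tuple nat) (f tau : nat -> nat).

Lemma keyt_map A x f : tval x = map f A -> keyt l x = map f (keyt l A).
Proof. by rewrite /keyt => ->; rewrite -map_take. Qed.

Lemma keytP A v : l <= n -> v \in keyt l A ->
  exists p, [/\ p < l, p < n & v = nth 0 A p].
Proof.
move=> ln /(nthP 0)[p]; rewrite size_takel ?size_tuple // => pl <-.
by exists p; split; rewrite ?nth_take // (leq_trans pl).
Qed.

Lemma mem_keyt A p : p < l -> p < n -> nth 0 A p \in keyt l A.
Proof.
move=> pl pn; rewrite -(nth_take 0 pl) mem_nth // size_take size_tuple.
by case: ifP.
Qed.

Lemma eq_map_nth (E : Type) (A B : n.-tuple nat) (f g : nat -> E) p :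
  map f A = map g B -> p < n -> f (nth 0 A p) = g (nth 0 B p).
Proof.
move=> e pn; rewrite -(nth_map 0 (f 0)) ?size_tuple // e.
by rewrite (nth_map 0) ?size_tuple.
Qed.

Lemma eq_map_key (E : Type) (A B : n.-tuple nat) (f g : nat -> E) :
  map f A = map g B -> map f (keyt l A) = map g (keyt l B).
Proof. by rewrite /keyt !map_take => ->. Qed.

(** [tau] and [f] agree on the variables of [A], which include the key of [B]; so a fact read as an
    instance of [A] fixes the key of every right-hand partner. *)
Lemma qmatch_right A B z x f : ksub (keyt l B) A ->
  qmatch A B z x -> tval z = map f A -> keyt l x = map f (keyt l B).
Proof.
move=> /allP BA [tau [-> ex]] /eq_in_map e.
by rewrite (keyt_map ex); apply/eq_in_map => v /BA /e.
Qed.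

Lemma qmatch_left A B z x f : ksub (keyt l A) B ->
  qmatch A B z x -> tval x = map f B -> keyt l z = map f (keyt l A).
Proof.
move=> /allP AB [tau [ez ->]] /eq_in_map e.
by rewrite (keyt_map ez); apply/eq_in_map => v /AB /e.
Qed.

Lemma qmatch_keyl A B z x : ksub (keyt l A) B -> qmatch A B z x ->
  {subset keyt l z <= tval x}.
Proof.
move=> /allP AB [tau [ez ->]] v; rewrite (keyt_map ez) => /mapP[w /AB wB ->].
exact: map_f.
Qed.

Lemma qmatch_sym A B z x : qmatch A B z x -> qmatch B A x z.
Proof. by case=> tau [ez ex]; exists tau. Qed.

Lemma qmatch_keyr A B z x : ksub (keyt l B) A -> qmatch A B z x ->
  {subset keyt l x <= tval z}.
Proof. by move=> BA /qmatch_sym; apply: qmatch_keyl. Qed.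

(** The symmetry in the two atoms is needed at the end, where [fresh_up] is secured only up to
    exchanging them. *)
Lemma satisfies_sym A B S : satisfies A B S -> satisfies B A S.
Proof.
by case=> a [b [aS [bS ab]]]; exists b, a; split=> //; split=> //; apply: qmatch_sym.
Qed.

Lemma certain_sym A B D : certain l A B D -> certain l B A D.
Proof. by move=> cD r /cD /satisfies_sym. Qed.

(** [Delta] occurs nested under an existential, so the induction hypothesis for [S'] is produced by
    an explicit [fix]. *)
Lemma Delta_ind_nested A B k D (P : seq (n.-tuple nat) -> Prop) :
  (forall S, kset l k D S -> satisfies A B S -> P S) ->
  (forall S (f : n.-tuple nat), kset l k D S -> f \in D ->
     (forall u, u \in D -> key_eq l u f -> exists S', subdb S' (u :: S) /\ P S') ->
     P S) ->
  forall S, Delta l A B k D S -> P S.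
Proof.
move=> Psat Pblock; fix IH 2 => S [{}S kS sS|{}S f kS fD H]; first exact: Psat.
apply: (Pblock S f) => // u uD uf; case: (H u uD uf) => S' [S'S DS'].
by exists S'; split=> //; apply: IH.
Qed.

Lemma Cert_sym A B k D : Cert l A B k D -> Cert l B A k D.
Proof.
rewrite /Cert; elim/Delta_ind_nested: _ / => [S kS /satisfies_sym|S f].
  exact: Delta_sat.
exact: Delta_block.
Qed.

Lemma repair_block (D r : seq (n.-tuple nat)) (f : n.-tuple nat) : is_repair l D r -> f \in D ->
  exists x, [/\ x \in r, x \in D & keyt l x = keyt l f].
Proof.
move=> [rD [cr maxr]] fD.
have [/hasP[x xr /eqP e]|/hasPn nf] := boolP (has (fun x => keyt l x == keyt l f) r).
  by exists x; split=> //; apply: rD.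
suff: f \in r by move/nf; rewrite eqxx.
apply: (maxr (f :: r)); rewrite ?mem_head //.
- by move=> x xr; rewrite inE xr orbT.
- by move=> x; rewrite inE => /predU1P[->|/rD].
move=> a b; rewrite !inE /key_eq.
move=> /predU1P[->|ar] /predU1P[->|br] // e; last exact: cr.
- by move: (nf _ br); rewrite eq_sym e.
- by move: (nf _ ar); rewrite e.
Qed.

End Matching.

(** * Losing a key element along a directed path *)

(** A solution is remembered only through the keys of its two facts, so that links can be
    concatenated block by block. *)
Definition key_link n l (A B : n.-tuple nat) (k1 k2 : seq nat) : Prop :=
  exists f : nat -> nat, k1 = map f (keyt l A) /\ k2 = map f (keyt l B).

Inductive key_path n l (A B : n.-tuple nat) : seq nat -> seq nat -> Prop :=
| KeyPathRefl k : key_path l A B k k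
| KeyPathStep k1 k2 k3 : key_link l A B k1 k2 \/ key_link l A B k2 k1 ->
    key_path l A B k2 k3 -> key_path l A B k1 k3.

Section Loss.
Variables (n l : nat) (A B : n.-tuple nat) (mu : nat -> nat -> nat).
Hypothesis ln : l <= n.
Hypothesis mu3 : forall s v, mu s.+3 v = mu s v.
Hypothesis muE : forall s, map (mu s) B = map (mu s.+1) A.

Lemma mu_step s p : p < l -> mu s (nth 0 B p) = mu s.+1 (nth 0 A p).
Proof. move=> pl; apply: (eq_map_nth (muE s)). by apply: leq_trans ln. Qed.

Lemma mu_mod s v : mu (s %% 3) v = mu s v.
Proof. by apply: (@periodic3 _ (mu^~ v)) => t; apply: mu3. Qed.

Lemma mu_eqmod s t v : s = t %[mod 3] -> mu s v = mu t v.
Proof. by move=> e; rewrite -mu_mod e mu_mod. Qed.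

(* [Z2_chain u y]: a finitely supported family of labellings over [Z/2] of the
   links at levels 0, 1, ..., compatible at every level except for a jump [u]
   at level [b] and a jump [y] at level [c]. *)
Definition Z2_chain (u y : nat -> bool) (b c : nat) (z : nat -> nat -> bool) :=
  [/\ [/\ 0 < b, 0 < c & forall v, z 0 v = false],
      exists N, forall s v, N <= s -> z s v = false &
      forall s p, p < l ->
        z s (nth 0 B p) (+) z s.+1 (nth 0 A p) =
        ((s.+1 == b) && u p) (+) ((s.+1 == c) && y p)].

Lemma Z2_chain_shift u y b c z d : Z2_chain u y b c z ->
  exists z', Z2_chain u y (d + b) (d + c) z'.
Proof.
case=> -[b0 c0 z0] [N zN] zE.
exists (fun s v => (d <= s) && z (s - d) v); split.
- by split=> [||v]; rewrite ?addn_gt0 ?b0 ?c0 ?orbT // sub0n z0 andbF.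
- by exists (N + d) => s v Ns; rewrite zN ?andbF //; lia.
move=> s p pl; have [ds|sd] := leqP d s.
  rewrite (leqW ds) /= subSn // zE //.
  by congr (_ && _ (+) (_ && _)); apply/eqP/eqP; lia.
have -> : (s.+1 == d + b) = false by lia.
have -> : (s.+1 == d + c) = false by lia.
rewrite /=; case: (ltnP s.+1 d) => //= dsl.
by have -> : s.+1 - d = 0 by lia.
Qed.

Variable g : nat.
(** The default [g.+1] differs from [g]: a position beyond the key does not carry [g]. *)
Notation bits k := (fun p => nth g.+1 k p == g).

(** Adding the indicator of [g] under [f] at level [c] cancels the jump on the [A] side and
    recreates it one level higher on the [B] side. [Z2_chain_down] reads the same correction
    backwards. *)
Lemma Z2_chain_up u b c z f :
  Z2_chain u (bits (map f (keyt l A))) b c z ->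
  exists z', Z2_chain u (bits (map f (keyt l B))) b c.+1 z'.
Proof.
case=> -[b0 c0 z0] [N zN] zE.
exists (fun s v => z s v (+) ((s == c) && (f v == g))); split.
- by split=> // v; rewrite z0 /=; case: c c0 {zE}.
- by exists (N + c.+1) => s v Ns; rewrite zN ?(leq_trans _ Ns) ?leq_addr // (gtn_eqF (leq_trans _ Ns)) // addnS ltnS leq_addl.
have szA : size (keyt l A) = l by rewrite size_takel ?size_tuple.
have szB : size (keyt l B) = l by rewrite size_takel ?size_tuple.
move=> s p pl; move: (zE s p pl).
rewrite !(nth_map 0) ?szA ?szB // !nth_take // eqSS => e.
by rewrite addbACA e -addbA; congr (_ (+) _); rewrite addbC addbK.
Qed.

Lemma Z2_chain_down u b c z f :
  Z2_chain u (bits (map f (keyt l B))) b c.+2 z ->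
  exists z', Z2_chain u (bits (map f (keyt l A))) b c.+1 z'.
Proof.
case=> -[b0 c0 z0] [N zN] zE.
exists (fun s v => z s v (+) ((s == c.+1) && (f v == g))); split.
- by split=> // v; rewrite z0.
- by exists (N + c.+2) => s v Ns; rewrite zN ?(leq_trans _ Ns) ?leq_addr // (gtn_eqF (leq_trans _ Ns)) // addnS ltnS leq_addl.
have szA : size (keyt l A) = l by rewrite size_takel ?size_tuple.
have szB : size (keyt l B) = l by rewrite size_takel ?size_tuple.
move=> s p pl; move: (zE s p pl).
rewrite !(nth_map 0) ?szA ?szB // !nth_take // !eqSS => e.
by rewrite addbACA e -addbA; congr (_ (+) _); rewrite addKb.
Qed.

Lemma Z2_chain_path u k1 k2 b c z : key_path l A B k1 k2 ->
  Z2_chain u (bits k1) b c z -> exists b' c' z', Z2_chain u (bits k2) b' c' z'.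
Proof.
move=> P; elim: P b c z => [k|{}k1 k k3 [] [f [-> ->]] _ IH] b c z H.
- by exists b, c, z.
- by case: (Z2_chain_up H) => z' /IH.
(* One extra level lets the jump move down without reaching level 0. *)
have [z' H'] := Z2_chain_shift 1 H.
by case: c H H' => [[[]]|c] // _ H'; have [z'' /IH] := Z2_chain_down H'.
Qed.

(* Over [Z/2] a path 0 -> x and a path x + u -> 0 give u -> x + u -> 0, where the
   first part is the sum of 0 -> x and of the periodic run [mu]. *)
Lemma directed_loss r0 r k : key_path l A B (map (mu r0) (keyt l A)) k -> g \notin k ->
  exists Y : nat -> nat -> bool,
  [/\ forall p, p < l -> Y 0 (nth 0 A p) = (mu r (nth 0 A p) == g),
      forall s p, p < l -> Y s (nth 0 B p) = Y s.+1 (nth 0 A p) &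
      exists N, forall s v, N <= s -> Y s v = false].
Proof.
(* Two equal jumps at level 1 cancel, so the zero labelling is a chain. *)
move=> P gk; have H0 : Z2_chain (bits (map (mu r0) (keyt l A)))
    (bits (map (mu r0) (keyt l A))) 1 1 (fun _ _ => false).
  split=> //; first by exists 0.
  by move=> s p _; rewrite [RHS]addbb.
have [b [c [z H]]] := Z2_chain_path P H0.
(* As 2 is invertible modulo 3, one of three consecutive shifts gives the required congruence. *)
have [b1 [c1 [z1 [eb {}H]]]] : exists b1 c1 z1, r0 + 2 * b1 = r %[mod 3] /\
    Z2_chain (bits (map (mu r0) (keyt l A))) (bits k) b1 c1 z1.
  have [z1 H1] := Z2_chain_shift (2 * (2 * r0 + b + r.+1)) H.
  have [z2 H2] := Z2_chain_shift (2 * (2 * r0 + b + r.+1) + 1) H.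
  have [z3 H3] := Z2_chain_shift (2 * (2 * r0 + b + r.+1) + 2) H.
  have [e|[e|e]] : r0 + 2 * (2 * (2 * r0 + b + r.+1) + b) = r %[mod 3] \/
     (r0 + 2 * (2 * (2 * r0 + b + r.+1) + 1 + b) = r %[mod 3] \/
     r0 + 2 * (2 * (2 * r0 + b + r.+1) + 2 + b) = r %[mod 3]) by lia.
  - by eexists _, _, _; split; first exact: e; exact: H1.
  - by eexists _, _, _; split; first exact: e; exact: H2.
  - by eexists _, _, _; split; first exact: e; exact: H3.
case: H => -[b0 _ z0] [N zN] zE.
have szA : size (keyt l A) = l by rewrite size_takel ?size_tuple.
(* The added run starts in phase [r0 + 2 * b1], that is [r], and reaches phase [r0] at level [b1],
   where it cancels the jump there. *)
exists (fun s v => z1 s v (+) ((s < b1) && (mu (r0 + 2 * b1 + s) v == g))); split.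
- by move=> p pl; rewrite z0 b0 /= (@mu_eqmod _ r) // addn0.
- move=> s p pl; move: (zE s p pl); rewrite (nth_map 0) ?szA // nth_take //.
  (* The other jump is zero because [g] is not in [k]. *)
  have -> : (nth g.+1 k p == g) = false.
    have [pk|pk] := ltnP p (size k); last by rewrite nth_default // gtn_eqF.
    by apply: contraNF gk => /eqP <-; rewrite mem_nth.
  rewrite andbF addbF mu_step // -addnS => e.
  have {e} -> : z1 s (nth 0 B p) = z1 s.+1 (nth 0 A p) (+)
      ((s.+1 == b1) && (mu r0 (nth 0 A p) == g)) by rewrite -e addbC addbK.
  rewrite -addbA; congr (_ (+) _); case: (ltngtP s.+1 b1) => [lt|gt|<-] /=.
  - by [].
  - by [].
  - by rewrite (@mu_eqmod _ r0) ?addbb //; lia.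
exists (N + b1) => s v Ns; rewrite zN ?(leq_trans _ Ns) ?leq_addr //.
by rewrite ltnNge (leq_trans _ Ns) ?leq_addl.
Qed.

End Loss.

(** * The database of hubs and connectors *)

(** Tags: 0 for core elements, 1 and 2 for the fresh elements of the blocks [U] and [D], 3 for
    elements private to one link. *)
Definition elt (tag pay : nat) (lb : nat * nat) : nat := pickle (tag, pay, lb).

Lemma elt_inj t t' p p' lb lb' : elt t p lb = elt t' p' lb' ->
  [/\ t = t', p = p' & lb = lb'].
Proof. by move=> /(pcan_inj pickleK)[-> -> ->]. Qed.

Lemma elt_tag t t' p p' lb lb' : t != t' -> elt t p lb = elt t' p' lb' -> False.
Proof. by move=> /eqP tt' /elt_inj[]. Qed.

(* A hub is a pair (hole, pigeon).  Its leg [0] leads to the pigeon, its legs [1]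
   and [2] to the odd and the even one of the two links [p], [p+1] around pigeon
   [p] in the chain of the hole. *)
Definition conn (i : nat * nat) (t : nat) : nat * nat * nat :=
  match t with
  | 0 => (0, 0, i.2)
  | 1 => (1, i.1, i.2 + ~~ odd i.2)
  | _ => (2, i.1, i.2 + odd i.2)
  end.

(** A link gives the hole, leg 0 gives the pigeon, and the two links around pigeon [p] sum to
    [2 * p + 1]. *)
Lemma conn_inj i i' t t' : t < 3 -> t' < 3 -> t != t' ->
  conn i t = conn i' t -> conn i t' = conn i' t' -> i = i'.
Proof.
case: i => h p; case: i' => h' p'.
case: t => [|[|[|t]]]; case: t' => [|[|[|t']]] //= _ _ _ e1 e2.
all: move: e1 e2 => /pair_equal_spec[/pair_equal_spec[_ ?] ?] /pair_equal_spec[/pair_equal_spec[_ ?] ?].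
all: congr (_, _) => //.
all: lia.
Qed.

Section Gadget.
Variables (n l : nat) (A B : n.-tuple nat).
Hypothesis ln : l <= n.
Notation alpha := (keyt l A).
Notation beta := (keyt l B).
Hypothesis alphaB : ksub alpha B.
Hypothesis betaA : ksub beta A.
Hypothesis beta_alpha : ~~ ksub beta alpha.
Hypothesis alpha_beta : ~~ ksub alpha beta.

Notation triple := (nat * nat * nat)%type.
(** [eta s] is the valuation of the triangle link leaving fact [s]. A leg has [T] levels; at level
    [j] its key elements are marked by the bits [Y j], starting from the intrinsic bit [omega]. *)
Variables (eta : nat -> nat -> triple) (omega : triple -> bool).
Variables (T : nat) (Y : nat -> nat -> bool).
Hypothesis eta3 : forall s v, eta s.+3 v = eta s v.
Hypothesis etaE : forall s, map (eta s) B = map (eta s.+1) A.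
Hypothesis eta_inj : forall s s', map (eta s) alpha = map (eta s') alpha ->
  s = s' %[mod 3].
Hypothesis T0 : 0 < T.
Hypothesis Y0 : forall s v, v \in alpha -> Y 0 v = omega (eta s v).
Hypothesis Ystep : forall j, j.+1 < T -> map (Y j) beta = map (Y j.+1) alpha.
Hypothesis Yinj : forall j j', j < T -> j' < T -> map (Y j) alpha = map (Y j') alpha ->
  j = j'.

(** These are the core elements in the key of the connector at the end of leg [t]. Several hubs
    share that key, so their label may depend on the connector only. *)
Definition in_end t (y : triple * bool) : bool :=
  y \in [seq (eta (t + T.-1) v, Y T.-1 v) | v <- alpha & v \in beta].
Definition ends (y : triple * bool) : seq nat := [seq t <- iota 0 3 | in_end t y].

(** Makes the key of [K_j] determine its hub: it has an element outside all connectors, or two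
    elements each lying in a single connector, for different legs. *)
Hypothesis anchored : forall t j, j < T ->
  (exists2 v, v \in alpha & ends (eta (t + j) v, Y j v) = [::]) \/
  exists v1 v2 t1 t2, [/\ v1 \in alpha, v2 \in alpha, t1 != t2,
    ends (eta (t + j) v1, Y j v1) = [:: t1] & ends (eta (t + j) v2, Y j v2) = [:: t2]].
Hypothesis fresh_up : exists p, [/\ p < n, nth 0 B p \in alpha ++ beta &
  nth 0 A p \notin alpha].
Hypothesis long_up : 1 < T -> exists p, [/\ p < l, nth 0 A p \in beta & nth 0 B p \notin alpha].
Hypothesis long_down : 1 < T -> exists p, [/\ p < l, nth 0 B p \in alpha & nth 0 A p \notin beta].

Notation hub := (nat * nat)%type.
Implicit Types (i : hub) (t j v : nat).

(* The label of a core element is the information on the hub shared by all the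
   connectors whose key contains this element. *)
Definition lab i (y : triple * bool) : nat * nat :=
  match ends y with
  | [::] => (1, pickle i)
  | [:: t] => (2, pickle (conn i t))
  | _ => (0, 0)
  end.

Definition core i (y : triple * bool) : nat := elt 0 (pickle y) (lab i y).

(** The last [U] block is the connector itself, common to several hubs. *)
Definition owner i t j : nat * nat :=
  if j.+1 == T then (2, pickle (conn i t)) else (1, pickle i).

Definition fresh_u i (t j v : nat) : nat := elt 1 (pickle (t, j, v)) (owner i t j).
Definition fresh_d i (t j v : nat) : nat := elt 2 (pickle (t, j, v)) (1, pickle i).
Definition priv i (t j k v : nat) : nat := elt 3 (pickle (t, j, k, v)) (1, pickle i).

Definition hub_val i (s v : nat) : nat := core i (eta s v, omega (eta s v)).

(* The links [K_j -> U_j], [D_j -> U_j] and [D_j -> K_{j+1}] of leg [t]. *)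
Definition m1 i (t j v : nat) : nat :=
  if v \in alpha then core i (eta (t + j) v, Y j v)
  else if v \in beta then fresh_u i t j v else priv i t j 1 v.
Definition m2 i (t j v : nat) : nat :=
  if v \in beta then
    if v \in alpha then core i (eta (t + j) v, Y j v) else fresh_u i t j v
  else if v \in alpha then fresh_d i t j v else priv i t j 2 v.
Definition m3 i (t j v : nat) : nat :=
  if v \in beta then core i (eta (t + j) v, Y j v)
  else if v \in alpha then fresh_d i t j v else priv i t j 3 v.

(* Level 0, 1, 2 stands for the blocks K_j, U_j, D_j; the starred fact of a block
   is the one chosen when the hub does not serve the leg. *)
Definition code := (nat * bool * hub * nat * nat)%type.

Definition fact (c : code) : n.-tuple nat :=
  let: (lev, star, i, t, j) := c in
  match lev, star with
  | 0, false => if j is j'.+1 then map_tuple (m3 i t j') B else map_tuple (hub_val i t) A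
  | 0, true => map_tuple (m1 i t j) A
  | 1, false => map_tuple (m1 i t j) B
  | 1, true => map_tuple (m2 i t j) B
  | _, false => map_tuple (m2 i t j) A
  | _, true => map_tuple (m3 i t j) A
  end.

Definition keyK i t j := map (fun v => core i (eta (t + j) v, Y j v)) alpha.
Definition keyU i t j := map (m1 i t j) beta.
Definition keyD i t j := map (m2 i t j) alpha.

Definition block (c : code) : seq nat :=
  let: (lev, _, i, t, j) := c in
  match lev with 0 => keyK i t j | 1 => keyU i t j | _ => keyD i t j end.

Lemma Ystep_nth j p : j.+1 < T -> p < l -> Y j (nth 0 B p) = Y j.+1 (nth 0 A p).
Proof.
move=> jT pl; have /(congr1 (fun s => nth false s p)) := Ystep jT.
by rewrite !(nth_map 0) ?size_takel ?size_tuple // !nth_take.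
Qed.

Lemma eta_nth s p : p < n -> eta s (nth 0 B p) = eta s.+1 (nth 0 A p).
Proof. exact: (eq_map_nth (etaE s)). Qed.

Lemma eta_mod s v : eta (s %% 3) v = eta s v.
Proof. by apply: (@periodic3 _ (eta^~ v)) => t; apply: eta3. Qed.

Lemma eta_eqmod s t v : s = t %[mod 3] -> eta s v = eta t v.
Proof. by move=> e; rewrite -eta_mod e eta_mod. Qed.

Lemma hub_val_step i s : map (hub_val i s) B = map (hub_val i s.+1) A.
Proof.
apply: (@eq_from_nth _ 0) => [|p]; rewrite !size_map !size_tuple // => pn.
by rewrite !(nth_map 0) ?size_tuple // /hub_val eta_nth.
Qed.

Lemma keyK0 i t : map (hub_val i t) alpha = keyK i t 0.
Proof. by apply/eq_in_map => v va; rewrite addn0 /hub_val (Y0 t va). Qed.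

Lemma map_nth_key (f g : nat -> nat) :
  (forall p, p < l -> f (nth 0 A p) = g (nth 0 B p)) -> map f alpha = map g beta.
Proof.
move=> e; apply: (@eq_from_nth _ 0) => [|p]; rewrite !size_map !size_takel ?size_tuple //.
by move=> pl; rewrite !(nth_map 0) ?size_takel ?size_tuple // !nth_take // e.
Qed.

Lemma keyK_step i t j : j.+1 < T ->
  map (fun v => core i (eta (t + j) v, Y j v)) beta = keyK i t j.+1.
Proof.
move=> jT; apply/esym/map_nth_key => p pl.
by rewrite Ystep_nth // eta_nth ?addnS // (leq_trans pl).
Qed.

Lemma m1_alpha i t j : map (m1 i t j) alpha = keyK i t j.
Proof. by apply/eq_in_map => v va; rewrite /m1 va. Qed.

Lemma m2_beta i t j : map (m2 i t j) beta = keyU i t j.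
Proof. by apply/eq_in_map => v vb; rewrite /m2 /m1 vb. Qed.

Lemma m3_alpha i t j : map (m3 i t j) alpha = keyD i t j.
Proof. by apply/eq_in_map => v va; rewrite /m2 /m3 va. Qed.

Lemma m3_beta i t j : j.+1 < T -> map (m3 i t j) beta = keyK i t j.+1.
Proof. by move=> jT; rewrite -keyK_step //; apply/eq_in_map => v vb; rewrite /m3 vb. Qed.

Definition okhub N i := (i.1 < N) && (i.2 <= N).

(** Only the links 1 to [N] lie between two of the pigeons 0 to [N]; a leg towards link 0 or [N.+1]
    ends without a connector. *)
Definition attached N i t :=
  match t with 0 => true | _ => (0 < (conn i t).2) && ((conn i t).2 <= N) end.

Definition valid N (c : code) : bool :=
  let: (lev, star, i, t, j) := c in
  [&& okhub N i, t < 3, lev < 3, j < T &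
   match lev, star with
   | 0, _ => true
   | 1, false => (j.+1 == T) ==> attached N i t
   | _, _ => j.+1 < T
   end].

Lemma key_fact N c : valid N c -> keyt l (fact c) = block c.
Proof.
case: c => [[[[lev star] i] t] j] /= /and5P[_ _ _ jT _].
case: lev => [|[|lev]]; case: star.
- by rewrite (@keyt_map _ _ A _ (m1 i t j)) // m1_alpha.
- case: j jT => [|j] jT; first by rewrite (@keyt_map _ _ A _ (hub_val i t)) // keyK0.
  by rewrite (@keyt_map _ _ B _ (m3 i t j)) // m3_beta.
- by rewrite (@keyt_map _ _ B _ (m2 i t j)) // m2_beta.
- by rewrite (@keyt_map _ _ B _ (m1 i t j)).
- by rewrite (@keyt_map _ _ A _ (m3 i t j)) // m3_alpha.
- by rewrite (@keyt_map _ _ A _ (m2 i t j)).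
Qed.

(** * Distinct blocks have distinct keys *)

Lemma mem_beta_alpha : exists2 v, v \in beta & v \notin alpha.
Proof. by have /allPn[v] := beta_alpha; exists v. Qed.

Lemma mem_alpha_beta : exists2 v, v \in alpha & v \notin beta.
Proof. by have /allPn[v] := alpha_beta; exists v. Qed.

Lemma core_inj i i' y y' : core i y = core i' y' -> y = y' /\ lab i y = lab i' y.
Proof. by move=> /elt_inj[_ /(pcan_inj pickleK) -> ->]. Qed.

(* An element labelled by the hub, or two elements labelled by different connectors
   of it, determine the hub. *)
Lemma core_hub i i' t j : j < T ->
  (forall v, v \in alpha -> exists y, core i (eta (t + j) v, Y j v) = core i' y) ->
  i = i'.
Proof.
move=> jT H; have labE v : v \in alpha ->
    lab i (eta (t + j) v, Y j v) = lab i' (eta (t + j) v, Y j v).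
  by move=> /H[y] /core_inj[].
have ends3 y s : ends y = [:: s] -> s < 3.
  move=> e; have : s \in ends y by rewrite e inE.
  by rewrite mem_filter mem_iota => /and3P[].
have [[v va ev]|[v1 [v2 [t1 [t2 [va1 va2 t12 e1 e2]]]]]] := anchored t jT.
  by move: (labE v va); rewrite /lab ev => -[/(pcan_inj pickleK)].
move: (labE v1 va1) (labE v2 va2); rewrite /lab e1 e2.
move=> [/(pcan_inj pickleK) c1] [/(pcan_inj pickleK) c2].
exact: (conn_inj (ends3 _ _ e1) (ends3 _ _ e2) t12 c1 c2).
Qed.

(** The bits give the level, the triples then give the phase and so the leg, and [core_hub] gives
    the hub. *)
Lemma keyK_inj i i' t t' j j' : j < T -> j' < T -> keyK i t j = keyK i' t' j' ->
  [/\ i = i', t = t' %[mod 3] & j = j'].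
Proof.
move=> jT j'T /eq_in_map H.
have E v : v \in alpha -> (eta (t + j) v, Y j v) = (eta (t' + j') v, Y j' v).
  by move=> /H /core_inj[].
have ej : j = j'.
  by apply: Yinj => //; apply/eq_in_map => v /E[].
subst j'; split=> //; first by apply: (core_hub jT) => v va; eexists; exact: (H v va).
have /eqP : t + j = t' + j %[mod 3] by apply: eta_inj; apply/eq_in_map => v /E[].
by rewrite eqn_modDr => /eqP.
Qed.

Lemma fresh_u_inj i i' t t' j j' v v' : fresh_u i t j v = fresh_u i' t' j' v' ->
  [/\ t = t', j = j', v = v' & owner i t j = owner i' t j].
Proof. by move=> /elt_inj[_ /(pcan_inj pickleK)[-> -> ->] ->]. Qed.

Lemma fresh_d_inj i i' t t' j j' v v' : fresh_d i t j v = fresh_d i' t' j' v' ->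
  [/\ i = i', t = t', j = j' & v = v'].
Proof.
by move=> /elt_inj[_ /(pcan_inj pickleK)[-> -> ->] [/(pcan_inj pickleK) ->]].
Qed.

Lemma owner_hub i i' t j : j.+1 != T -> owner i t j = owner i' t j -> i = i'.
Proof. by rewrite /owner => /negbTE -> [/(pcan_inj pickleK)]. Qed.

Lemma keyU_fresh i t j : exists2 v, v \in beta & fresh_u i t j v \in keyU i t j.
Proof.
have [v vb va] := mem_beta_alpha; exists v => //; apply/mapP; exists v => //.
by rewrite /m1 vb (negbTE va).
Qed.

Lemma keyD_fresh i t j : exists v, fresh_d i t j v \in keyD i t j.
Proof.
have [v va vb] := mem_alpha_beta; exists v; apply/mapP; exists v => //.
by rewrite /m2 va (negbTE vb).
Qed.

Ltac bytag := by move/elt_tag => /(_ isT).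

Lemma fresh_u_keyK i t j v i' t' j' : fresh_u i t j v \notin keyK i' t' j'.
Proof. by apply/mapP => -[w _]; bytag. Qed.

Lemma fresh_d_keyK i t j v i' t' j' : fresh_d i t j v \notin keyK i' t' j'.
Proof. by apply/mapP => -[w _]; bytag. Qed.

Lemma fresh_u_keyD i t j v i' t' j' : fresh_u i t j v \notin keyD i' t' j'.
Proof. by apply/mapP => -[w wa]; rewrite /m2 wa; case: ifP => _; bytag. Qed.

Lemma fresh_d_keyU i t j v i' t' j' : fresh_d i t j v \notin keyU i' t' j'.
Proof. by apply/mapP => -[w wb]; rewrite /m1 wb; case: ifP => _; bytag. Qed.

Lemma fresh_u_mem_keyU i t j v i' t' j' : fresh_u i t j v \in keyU i' t' j' ->
  [/\ t = t', j = j' & owner i t j = owner i' t j].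
Proof.
by move=> /mapP[w wb]; rewrite /m1 wb; case: ifP => _; [bytag|move=> /fresh_u_inj[]].
Qed.

Lemma fresh_d_mem_keyD i t j v i' t' j' : fresh_d i t j v \in keyD i' t' j' ->
  [/\ i = i', t = t' & j = j'].
Proof.
by move=> /mapP[w wa]; rewrite /m2 wa; case: ifP => _; [bytag|move=> /fresh_d_inj[]].
Qed.

Lemma keyU_inj i t j i' t' j' : keyU i t j = keyU i' t' j' ->
  [/\ t = t', j = j' & owner i t j = owner i' t j].
Proof. by have [v _ H] := keyU_fresh i t j => e; move: H; rewrite e => /fresh_u_mem_keyU. Qed.

Lemma keyD_inj i t j i' t' j' : keyD i t j = keyD i' t' j' ->
  [/\ i = i', t = t' & j = j'].
Proof. by have [v H] := keyD_fresh i t j => e; move: H; rewrite e => /fresh_d_mem_keyD. Qed.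

Lemma keyKU i t j i' t' j' : keyK i t j <> keyU i' t' j'.
Proof. by have [v _ H] := keyU_fresh i' t' j' => e; move: H; rewrite -e (negbTE (fresh_u_keyK _ _ _ _ _ _ _)). Qed.

Lemma keyKD i t j i' t' j' : keyK i t j <> keyD i' t' j'.
Proof. by have [v H] := keyD_fresh i' t' j' => e; move: H; rewrite -e (negbTE (fresh_d_keyK _ _ _ _ _ _ _)). Qed.

Lemma keyUD i t j i' t' j' : keyU i t j <> keyD i' t' j'.
Proof. by have [v H] := keyD_fresh i' t' j' => e; move: H; rewrite -e (negbTE (fresh_d_keyU _ _ _ _ _ _ _)). Qed.

(** * Exclusion of unintended solutions *)

Lemma priv_block i t j k v c : priv i t j k v \notin block c.
Proof.
case: c => [[[[lev star] i'] t'] j'] /=; case: lev => [|[|lev]].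
- by apply/mapP => -[w _]; bytag.
- by apply/mapP => -[w wb]; rewrite /m1 wb; case: ifP => _; bytag.
- by apply/mapP => -[w wa]; rewrite /m2 wa; case: ifP => _; bytag.
Qed.

Lemma fresh_u_m3 i t j v i' t' j' s : fresh_u i t j v \notin map (m3 i' t' j') s.
Proof.
by apply/mapP => -[w _]; rewrite /m3; case: ifP => _; [bytag|case: ifP => _; bytag].
Qed.

Lemma fresh_d_m1 i t j v i' t' j' s : fresh_d i t j v \notin map (m1 i' t' j') s.
Proof.
by apply/mapP => -[w _]; rewrite /m1; case: ifP => _; [bytag|case: ifP => _; bytag].
Qed.

Lemma fresh_d_m2 i t j v i' t' j' s : fresh_d i t j v \in map (m2 i' t' j') s ->
  [/\ i = i', t = t' & j = j'].
Proof.
move=> /mapP[w _]; rewrite /m2; case: ifP => _; case: ifP => _; try bytag.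
by move=> /fresh_d_inj[].
Qed.

Lemma fresh_d_m3 i t j v i' t' j' s : fresh_d i t j v \in map (m3 i' t' j') s ->
  [/\ i = i', t = t' & j = j'].
Proof.
move=> /mapP[w _]; rewrite /m3; case: ifP => _; try bytag.
by case: ifP => _; try bytag; move=> /fresh_d_inj[].
Qed.

Lemma keyK_m1 i i' t j s : j < T -> {subset keyK i t j <= map (m1 i' t j) s} -> i = i'.
Proof.
move=> jT H; apply: (core_hub jT) => v va.
have /H/mapP[w _] : core i (eta (t + j) v, Y j v) \in keyK i t j by apply/mapP; exists v.
rewrite /m1; case: ifP => _; first by eexists; eassumption.
by case: ifP => _; bytag.
Qed.

(* Position [fresh_up] of the lower fact of the link [K_j -> U_j] carries a fresh
   element, which lies in a key of any other solution this fact takes part in. *)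
Lemma fresh_up_left N c i t j : valid N c ->
  qmatch A B (fact c) (map_tuple (m1 i t j) A) ->
  exists v, fresh_u i t j v \in block c.
Proof.
move=> vc Q; have [tau [ec ex]] := Q.
have kx : map tau beta = keyK i t j.
  rewrite -(keyt_map l ex) -m1_alpha (@keyt_map _ _ A _ (m1 i t j)) //.
have kc : map tau alpha = block c by rewrite -(key_fact vc) (keyt_map l ec).
have [p [pn Bp Ap]] := fresh_up.
have e : m1 i t j (nth 0 A p) = tau (nth 0 B p) by apply: eq_map_nth ex pn.
have {Bp} : tau (nth 0 B p) \in block c \/ tau (nth 0 B p) \in keyK i t j.
  by rewrite -kc -kx; move: Bp; rewrite mem_cat => /orP[H|H]; [left|right]; apply: map_f.
rewrite -e /m1 (negbTE Ap); case: ifP => _ [].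
- by exists (nth 0 A p).
- by rewrite (negbTE (fresh_u_keyK _ _ _ _ _ _ _)).
- by rewrite (negbTE (priv_block _ _ _ _ _ _)).
- by rewrite (negbTE (priv_block _ _ _ _ _ (0, true, i, t, j))).
Qed.

(** Necessary for a solution, but blind to levels; this suffices because a state makes the same
    choice all along a leg. *)
Definition clash (c c' : code) : Prop :=
  let: (_, star, i, t, _) := c in let: (_, star', i', t', _) := c' in
  i = i' /\ if t == t' then star != star' else ~~ star && ~~ star'.

Lemma fact_key_sub N c c' : valid N c -> valid N c' -> qmatch A B (fact c) (fact c') ->
  {subset block c <= tval (fact c')} /\ {subset block c' <= tval (fact c)}.
Proof.
move=> vc vc' Q; rewrite -(key_fact vc) -(key_fact vc').
by split; [apply: qmatch_keyl Q|apply: qmatch_keyr Q].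
Qed.

Lemma block_left N c c' f : valid N c -> qmatch A B (fact c) (fact c') ->
  tval (fact c') = map f B -> block c = map f alpha.
Proof. by move=> vc Q e; rewrite -(key_fact vc); apply: qmatch_left Q e. Qed.

Lemma block_right N c c' f : valid N c' -> qmatch A B (fact c) (fact c') ->
  tval (fact c) = map f A -> block c' = map f beta.
Proof. by move=> vc Q e; rewrite -(key_fact vc); apply: qmatch_right Q e. Qed.

Lemma mod3_small t t' : t < 3 -> t' < 3 -> t = t' %[mod 3] -> t = t'.
Proof. by move=> ? ?; rewrite !modn_small. Qed.

Lemma fresh_d_hub i t j v i' s r : fresh_d i t j v \notin map (hub_val i' s) r.
Proof. by apply/mapP => -[w _]; bytag. Qed.

(** At the position given by [long_up] the left fact carries a fresh element, where a solution needs
    an element of the key of [K_j]. *)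
Lemma no_upper_solution i t j : 1 < T ->
  ~ qmatch A B (map_tuple (m2 i t j) B) (map_tuple (m1 i t j) A).
Proof.
move=> T1 [tau [/= ez ex]]; have [p [pl Ap Bp]] := long_up T1.
have pn := leq_trans pl ln.
have e := eq_map_nth ez pn.
have kx : keyK i t j = map tau beta by rewrite -m1_alpha (eq_map_key l ex).
have : tau (nth 0 A p) \in keyK i t j by rewrite kx; apply: map_f.
rewrite -e /m2 (negbTE Bp); case: ifP => [_|].
  by rewrite (negbTE (fresh_u_keyK _ _ _ _ _ _ _)).
by rewrite mem_keyt.
Qed.

Lemma no_lower_solution i t j : j.+1 < T ->
  ~ qmatch A B (map_tuple (m3 i t j) B) (map_tuple (m2 i t j) A).
Proof.
move=> jT [tau [/= ez ex]]; have [p [pl Bp Ap]] := long_down (leq_ltn_trans (ltn0Sn j) jT).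
have pn := leq_trans pl ln.
have e := eq_map_nth ex pn.
have kz : keyK i t j.+1 = map tau alpha by rewrite -m3_beta // (eq_map_key l ez).
have : tau (nth 0 B p) \in keyK i t j.+1 by rewrite kz; apply: map_f.
rewrite -e /m2 (negbTE Ap) mem_keyt //.
by rewrite (negbTE (fresh_d_keyK _ _ _ _ _ _ _)).
Qed.

Lemma solution_clash N c c' : valid N c -> valid N c' ->
  qmatch A B (fact c) (fact c') -> clash c c'.
Proof.
case: c => [[[[lev star] i] t] j]; case: c' => [[[[lev' star'] i'] t'] j'] vc vc' Q.
have := vc => /and5P[_ t3 l3 jT H]; have := vc' => /and5P[_ t3' l3' jT' H'].
have [sub sub'] := fact_key_sub vc vc' Q.
(* A starred [K] fact on the right forces a fresh element into the left key, hence a [U] block on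
   the left. *)
have lowK : lev' = 0 -> star' -> lev = 1 /\ exists v, fresh_u i' t' j' v \in keyU i t j.
  move=> e' s'; subst lev'; case: star' s' vc' Q {H' sub sub'} => // _ vc' Q.
  have [v] := fresh_up_left vc Q; case: lev l3 H vc Q => [|[|[]]] //= _ _ _ _.
  - by rewrite (negbTE (fresh_u_keyK _ _ _ _ _ _ _)).
  - by move=> Hv; split=> //; exists v.
  - by rewrite (negbTE (fresh_u_keyD _ _ _ _ _ _ _)).
have L := block_left vc Q; have R := block_right vc' Q.
(* Right-hand fact: starred [K], [U], [D], then unstarred. An instance of [B] fixes the left key; a
   [D] fact forces a fresh element into the left fact. *)
case: star' lev' l3' vc' H' Q sub sub' lowK L R => [] [|[|[|lev']]] //= _ vc' H' Q sub sub' lowK L R.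
- have [el [v Hv]] := lowK erefl isT; subst lev.
  have [et ej eo] := fresh_u_mem_keyU Hv; subst t' j'.
  case: star vc H Q sub sub' {L R lowK} => vc H Q sub sub'; last first.
    by split; [rewrite (keyK_m1 jT sub')|rewrite eqxx].
  have ei := owner_hub (negbT (ltn_eqF H)) eo; subst i'.
  by case: (@no_upper_solution i t j); first apply: leq_ltn_trans H.
- have e := L _ (erefl (map (m2 i' t' j') B)).
  case: lev l3 vc H Q sub sub' lowK L R e => [|[|[|]]] //= _ vc H Q sub sub' lowK L R e.
  - by case: (keyKD e).
  - by case: (keyUD e).
  have [ei et ej] := keyD_inj e; subst i' t' j'; case: star vc H Q sub sub' L R {lowK}; last by rewrite eqxx.
  move=> vc H Q sub sub' L R.
  have := R _ (erefl (map (m3 i t j) A)); rewrite m3_beta // => /esym /keyKU [].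
- have [v /sub' Hv] := keyD_fresh i' t' j'.
  case: lev star l3 vc H Q sub sub' lowK L R Hv => [|[|[|]]] [] //= _ vc H Q sub sub' lowK L R Hv.
  - by rewrite (negbTE (fresh_d_m1 _ _ _ _ _ _ _ _)) in Hv.
  - case: j jT vc Q sub sub' lowK L R Hv H => [|j] jT vc Q sub sub' lowK L R Hv H.
      by rewrite (negbTE (fresh_d_hub _ _ _ _ _ _ _)) in Hv.
    by have [-> -> _] := fresh_d_m3 Hv; rewrite eqxx.
  - have [u _ /sub] := keyU_fresh i t j.
    by rewrite (negbTE (fresh_u_m3 _ _ _ _ _ _ _ _)).
  - by rewrite (negbTE (fresh_d_m1 _ _ _ _ _ _ _ _)) in Hv.
  - by have := R _ (erefl (map (m3 i t j) A)); rewrite m3_beta // => /esym /keyKD [].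
  - by have [-> -> _] := fresh_d_m2 Hv; rewrite eqxx.
- case: j' vc' H' Q sub sub' lowK L R jT' => [|j'] vc' H' Q sub sub' lowK L R jT'.
    (* A triangle fact is also an instance of [B], by the preceding valuation, which is [t'.+2]
       modulo 3. *)
    have /L e : map (hub_val i' t') A = map (hub_val i' t'.+2) B.
      by rewrite hub_val_step; apply: eq_map => v; rewrite /hub_val eta3.
    rewrite keyK0 in e.
    case: lev star l3 vc H Q sub sub' lowK L R e => [|[|[|]]] [] //= _ vc H Q sub sub' lowK L R e.
    - by have := R _ (erefl (map (m1 i t j) A)) => /keyKU [].
    - have [-> /eqP et _] := keyK_inj jT jT' e; split=> //.
      by case: (t =P t') et => // ->; lia.
    - by case: (keyKU (esym e)).
    - by case: (keyKU (esym e)).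
    - by case: (keyKD (esym e)).
    - by case: (keyKD (esym e)).
  have e := L _ (erefl (map (m3 i' t' j') B)); rewrite m3_alpha in e.
  case: lev l3 vc H Q sub sub' lowK L R e => [|[|[|]]] //= _ vc H Q sub sub' lowK L R e.
  - by case: (keyKD e).
  - by case: (keyUD e).
  have [ei et ej] := keyD_inj e; subst i' t' j'; case: star vc H Q sub sub' L R {lowK}; first by rewrite eqxx.
  move=> vc H Q sub sub' L R.
  by have := R _ (erefl (map (m2 i t j) A)); rewrite m2_beta => /keyKU [].
- have e := L _ (erefl (map (m1 i' t' j') B)); rewrite m1_alpha in e.
  case: lev star l3 vc H Q sub sub' lowK L R e => [|[|[|]]] [] //= _ vc H Q sub sub' lowK L R e.
  - by have [-> /(mod3_small t3 t3') -> _] := keyK_inj jT jT' e; rewrite eqxx.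
  - case: j jT vc Q sub sub' lowK L R e H => [|j] jT vc Q sub sub' lowK L R e H.
      have := R _ (erefl (map (hub_val i t) A)).
      by rewrite (eq_map_key l (hub_val_step i t)) keyK0 => /esym /keyKU [].
    have [v _ /sub'] := keyU_fresh i' t' j'.
    by rewrite (negbTE (fresh_u_m3 _ _ _ _ _ _ _ _)).
  - by case: (keyKU (esym e)).
  - by case: (keyKU (esym e)).
  - by case: (keyKD (esym e)).
  - by case: (keyKD (esym e)).
- have [v /sub' Hv] := keyD_fresh i' t' j'.
  case: lev star l3 vc H Q sub sub' lowK L R Hv => [|[|[|]]] [] //= _ vc H Q sub sub' lowK L R Hv.
  - by rewrite (negbTE (fresh_d_m1 _ _ _ _ _ _ _ _)) in Hv.
  - case: j jT vc Q sub sub' lowK L R Hv H => [|j] jT vc Q sub sub' lowK L R Hv H.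
      by rewrite (negbTE (fresh_d_hub _ _ _ _ _ _ _)) in Hv.
    have [ei et ej] := fresh_d_m3 Hv; subst i' t' j'.
    by case: (no_lower_solution H' Q).
  - by have [-> -> _] := fresh_d_m2 Hv; rewrite eqxx.
  - by rewrite (negbTE (fresh_d_m1 _ _ _ _ _ _ _ _)) in Hv.
  - by have [-> -> _] := fresh_d_m3 Hv; rewrite eqxx.
  - by have := R _ (erefl (map (m2 i t j) A)); rewrite m2_beta => /esym /keyUD [].
Qed.

(** * The database and its blocks *)

Definition codes N : seq code :=
  [seq (c, j) | c <- [seq (c, t) | c <- [seq (c, i) |
      c <- [seq (lev, star) | lev <- iota 0 3, star <- [:: false; true]],
      i <- [seq (h, p) | h <- iota 0 N, p <- iota 0 N.+1]],
    t <- iota 0 3], j <- iota 0 T].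

Definition db N : seq (n.-tuple nat) := [seq fact c | c <- codes N & valid N c].

Lemma dbP N f : reflect (exists2 c, valid N c & f = fact c) (f \in db N).
Proof.
apply: (iffP mapP) => [[c]|[c vc ->]]; first by rewrite mem_filter => /andP[]; exists c.
exists c => //; rewrite mem_filter vc; case: c vc => [[[[lev star] [h p]] t] j].
move=> /and5P[/andP[/= hN pN] t3 l3 jT _].
by rewrite !(allpairs_f pair) ?mem_iota ?add0n //; case: star; rewrite !inE.
Qed.

Lemma valid_fact N c : valid N c -> fact c \in db N.
Proof. by move=> vc; apply/dbP; exists c. Qed.

Lemma solution_KU i t j : qmatch A B (fact (0, true, i, t, j)) (fact (1, false, i, t, j)).
Proof. by exists (m1 i t j). Qed.

Lemma solution_DU i t j : qmatch A B (fact (2, false, i, t, j)) (fact (1, true, i, t, j)).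
Proof. by exists (m2 i t j). Qed.

Lemma solution_DK i t j : qmatch A B (fact (2, true, i, t, j)) (fact (0, false, i, t, j.+1)).
Proof. by exists (m3 i t j). Qed.

Lemma solution_hub i t t' : t' = t.+1 %[mod 3] ->
  qmatch A B (fact (0, false, i, t, 0)) (fact (0, false, i, t', 0)).
Proof.
move=> e; exists (hub_val i t); split=> //=.
by rewrite hub_val_step; apply: eq_map => v; rewrite /hub_val (eta_eqmod _ e).
Qed.

Lemma block_inj N c c' : valid N c -> valid N c' -> block c = block c' ->
  let: (lev, _, i, t, j) := c in let: (lev', _, i', t', j') := c' in
  [/\ lev = lev', t = t', j = j' &
   if (lev == 1) && (j.+1 == T) then conn i t = conn i' t else i = i'].
Proof.
case: c => [[[[lev star] i] t] j]; case: c' => [[[[lev' star'] i'] t'] j'].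
move=> /and5P[_ t3 l3 jT _] /and5P[_ t3' l3' jT' _].
case: lev l3 => [|[|[|]]] // _; case: lev' l3' => [|[|[|]]] //= _ e.
- by have [-> /(mod3_small t3 t3') -> ->] := keyK_inj jT jT' e.
- by case: (keyKU e).
- by case: (keyKD e).
- by case: (keyKU (esym e)).
- have [-> ->] := keyU_inj e; rewrite /owner; case: ifP => _ [] /(pcan_inj pickleK) -> //.
- by case: (keyUD e).
- by case: (keyKD (esym e)).
- by case: (keyUD (esym e)).
- by have [-> -> ->] := keyD_inj e.
Qed.

(** No label in this key sees more of the hub than the connector: a core element has [t] among its
    [ends], so it is labelled by this connector or, with several ends, by the constant [(0, 0)]. *)
Lemma block_end N i i' t star star' : valid N (1, star, i, t, T.-1) ->
  conn i t = conn i' t -> block (1, star, i, t, T.-1) = block (1, star', i', t, T.-1).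
Proof.
move=> /and5P[_ t3 _ _ _] e; apply/eq_in_map => v vb; rewrite /m1 vb.
case: ifP => va; last by rewrite /fresh_u /owner prednK // eqxx e.
congr elt; rewrite /lab.
have : t \in ends (eta (t + T.-1) v, Y T.-1 v).
  rewrite mem_filter mem_iota /= t3 andbT; apply/mapP; exists v => //.
  by rewrite mem_filter vb.
by case: (ends _) => [|s [|]] //; rewrite inE => /eqP <-; rewrite e.
Qed.

(** * Certainty: service propagates from a connector to its hub *)

Section Certain.
Variables (N : nat) (r : seq (n.-tuple nat)).
Hypothesis rep : is_repair l (db N) r.
Hypothesis unsat : ~ satisfies A B r.

Lemma repair_hit c : valid N c ->
  exists c', [/\ valid N c', fact c' \in r & block c' = block c].
Proof.
move=> vc; have [x [xr /dbP[c' vc' ex] e]] := repair_block rep (valid_fact vc).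
by exists c'; split=> //; rewrite -?ex // -(key_fact vc) -(key_fact vc') -ex.
Qed.

Lemma repair_pair lev i t j : valid N (lev, false, i, t, j) -> valid N (lev, true, i, t, j) ->
  fact (lev, true, i, t, j) \notin r -> fact (lev, false, i, t, j) \in r.
Proof.
move=> vc vc' H; have [[[[[lev1 star1] i1] t1] j1] [v1 r1 e]] := repair_hit vc.
have [el et ej] := block_inj v1 vc e; subst lev1 t1 j1.
case: ifP => [/andP[/eqP el /eqP ej]|_ ei].
  by move: vc' => /and5P[_ _ _ _]; rewrite el ej ltnn.
by subst i1; case: star1 {v1 e} r1 => // r1; rewrite r1 in H.
Qed.

Lemma not_both x y : x \in r -> qmatch A B x y -> y \notin r.
Proof. by move=> xr Q; apply/negP => yr; apply: unsat; exists x, y. Qed.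

Lemma not_both' x y : y \in r -> qmatch A B x y -> x \notin r.
Proof. by move=> yr Q; apply/negP => xr; apply: unsat; exists x, y. Qed.

(** Each solution rules out one fact and leaves its block no choice: unstarred [U_j], then [K_j],
    then [D] and [U] one level lower, down to the hub. *)
Lemma served_leg i t j : okhub N i -> t < 3 -> j < T ->
  fact (1, false, i, t, j) \in r -> fact (0, false, i, t, 0) \in r.
Proof.
move=> ok t3; elim: j => [|j IH] jT H.
  by apply: repair_pair (not_both' H (solution_KU i t 0)); rewrite /valid ok t3 jT.
have vS lev star : lev < 3 -> valid N (lev, star, i, t, j).
  move=> l3; rewrite /valid ok t3 l3 (ltnW jT) jT (ltn_eqF jT).
  by case: lev l3 star => [|[|lev]] _ [].
apply: IH; first exact: ltnW.
have K : fact (0, false, i, t, j.+1) \in r.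
  by apply: repair_pair (not_both' H (solution_KU i t j.+1)); rewrite /valid ok t3 jT.
have D : fact (2, false, i, t, j) \in r.
  by apply: repair_pair (not_both' K (solution_DK i t j)); apply: vS.
by apply: repair_pair (not_both D (solution_DU i t j)); apply: vS.
Qed.

Lemma one_served i t t' : t < 3 -> t' < 3 -> fact (0, false, i, t, 0) \in r ->
  fact (0, false, i, t', 0) \in r -> t = t'.
Proof.
move=> t3 t3' H H'; case: (t =P t') => // /eqP tt'; case: unsat.
have [e|e] : t' = t.+1 %[mod 3] \/ t = t'.+1 %[mod 3] by move: tt'; lia.
  by eexists; eexists; split; first exact: H; split; first exact: H'; apply: solution_hub.
by eexists; eexists; split; first exact: H'; split; first exact: H; apply: solution_hub.
Qed.

End Certain.

(** Chooses a hub and a leg for each connector: a pigeon, or link [j.+1] of a hole, reached from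
    pigeon [j]. *)
Definition conn_rep N (c : 'I_N.+1 + 'I_N * 'I_N) : hub * nat :=
  match c with
  | inl p => ((0, val p), 0)
  | inr (h, j) => ((val h, val j), (odd j).+1)
  end.

Lemma conn_rep_link N (h j : 'I_N) :
  conn (conn_rep (inr (h, j))).1 (conn_rep (inr (h, j) : 'I_N.+1 + _)).2 =
    ((odd j).+1, val h, j.+1).
Proof. by rewrite /conn /=; case: (odd j); rewrite /= addn1. Qed.

Lemma conn_rep_inj N (c c' : 'I_N.+1 + 'I_N * 'I_N) :
  conn (conn_rep c).1 (conn_rep c).2 = conn (conn_rep c').1 (conn_rep c').2 -> c = c'.
Proof.
case: c => [p|[h j]]; case: c' => [p'|[h' j']]; rewrite ?conn_rep_link //=.
- by case=> e; congr inl; apply: val_inj.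
- by case=> _ eh ej; congr inr; congr (_, _); apply: val_inj.
Qed.

Lemma conn_rep_valid N (c : 'I_N.+1 + 'I_N * 'I_N) : 0 < N ->
  valid N (1, false, (conn_rep c).1, (conn_rep c).2, T.-1).
Proof.
move=> N0; rewrite /valid prednK // leqnn eqxx /=.
case: c => [p|[h j]] /=; first by rewrite /okhub /= N0 -ltnS ltn_ord.
rewrite /okhub /= ltn_ord (ltnW (ltn_ord j)) /=.
by move: (ltn_ord j); rewrite /attached /conn /=; case: (odd j) => /=; rewrite addn1.
Qed.

(* Each of the [N^2 + N + 1] connectors is served by one of the [N (N + 1)] hubs,
   and no hub serves two of them. *)
Lemma certain_db N : 0 < N -> certain l A B (db N).
Proof.
move=> N0 r rep; apply: NNPP => unsat.
have H (c : 'I_N.+1 + 'I_N * 'I_N) : exists i : 'I_N * 'I_N.+1,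
    conn (val i.1, val i.2) (conn_rep c).2 = conn (conn_rep c).1 (conn_rep c).2 /\
    fact (0, false, (val i.1, val i.2), (conn_rep c).2, 0) \in r.
  have vc := conn_rep_valid c N0.
  have [[[[[lev star] [h p]] t] j] [v1 r1 e]] := repair_hit rep vc.
  have [el et ej] := block_inj v1 vc e; subst lev t j.
  rewrite prednK // !eqxx /= => ec.
  have /and5P[/andP[/= hN pN] t3 _ jT H1] := v1.
  case: star H1 r1 {v1 e} => [|_ r1]; first by rewrite prednK // ltnn.
  exists (Ordinal hN, Ordinal (pN : p < N.+1)).
  have ok : okhub N (h, p) by rewrite /okhub /= hN.
  by split; [exact: ec|exact: (served_leg rep unsat ok t3 jT r1)].
have [f Hf] := fin_all_exists H.
have finj : injective f.
  move=> c c' e; have [cc rc] := Hf c; have [cc' rc'] := Hf c'.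
  apply: conn_rep_inj; rewrite -cc -cc'; rewrite -e in rc' *.
  have /and5P[_ t3 _ _ _] := conn_rep_valid c N0.
  have /and5P[_ t3' _ _ _] := conn_rep_valid c' N0.
  by rewrite (one_served unsat t3 t3' rc rc').
have := leq_card f finj; rewrite card_sum !card_prod !card_ord; lia.
Qed.

(* A state assigns to each hole the pigeon sitting in it. *)
Definition serves (o : nat -> nat) (i : hub) : nat :=
  if i.2 == o i.1 then 0
  else if i.2 < o i.1 then (odd i.2).+1 else (~~ odd i.2).+1.

Definition chosen o (c : code) : bool :=
  let: (_, star, i, t, _) := c in star == (serves o i != t).

Lemma clash_chosen o c c' : clash c c' -> chosen o c -> ~~ chosen o c'.
Proof.
case: c => [[[[lev star] i] t] j]; case: c' => [[[[lev' star'] i'] t'] j'] /= [<-].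
case: (t =P t') => [<-|/eqP tt'].
  by case: star; case: star'; case: (serves o i == t).
by move=> /andP[/negbTE -> /negbTE ->]; case: (serves o i =P t) => // ->; rewrite tt'.
Qed.

(** The invariant refuting [Cert]: the facts follow a common assignment of distinct pigeons to the
    holes. *)
Definition state_set N (S : seq (n.-tuple nat)) : Prop :=
  exists o : nat -> nat,
  [/\ forall h, h < N -> o h <= N,
      forall h h', h < N -> h' < N -> o h = o h' -> h = h' &
      forall x, x \in S -> exists c, [/\ valid N c, chosen o c & x = fact c]].

Lemma state_set_unsat N S : state_set N S -> ~ satisfies A B S.
Proof.
move=> [o [_ _ H]] [x [y [/H[c [vc oc ->]] [/H[c' [vc' oc' ->]] Q]]]].
by have := clash_chosen (solution_clash vc vc' Q) oc; rewrite oc'.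
Qed.

Lemma list_choice (X C : eqType) (P : X -> C -> Prop) (s : seq X) :
  (forall x, x \in s -> exists c, P x c) ->
  exists cs : seq C, size cs = size s /\
    forall x, x \in s -> exists2 c, c \in cs & P x c.
Proof.
elim: s => [|x s IH] H; first by exists [::].
have [c Pc] := H x (mem_head _ _).
have [cs [sz Hcs]] := IH (fun y ys => H y (mem_behead (ys : y \in behead (x :: s)))).
exists (c :: cs); split=> [|y]; first by rewrite /= sz.
rewrite inE => /predU1P[->|/Hcs[c' c's Pc']]; first by exists c; rewrite ?mem_head.
by exists c'; rewrite // inE c's orbT.
Qed.

(** Hubs before the seated pigeon serve the link above them, later hubs the link below; so link [q]
    of hole [h] is served at [q.-1] if [q <= o h], else at [q]. *)
Lemma link_server N (o : nat -> nat) i t : 0 < t < 3 -> okhub N i -> attached N i t ->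
  exists2 p, p <= N & conn (i.1, p) t = conn i t /\ serves o (i.1, p) = t.
Proof.
case: i => h p /andP[t0 t3] /andP[/= hN pN] at_t.
have [q [q0 qN ot cE]] : exists q, [/\ 0 < q, q <= N, t = (~~ odd q).+1 &
    conn (h, p) t = (t, h, q)].
  case: t t0 t3 at_t => [|[|[|]]] //= _ _ /andP[q0 qN].
    by exists (p + ~~ odd p); split=> //; case op: (odd p) => /=; lia.
  by exists (p + odd p); split=> //; case op: (odd p) => /=; lia.
have oq : odd q = ~~ odd q.-1 by rewrite -{1}(prednK q0).
rewrite cE ot /serves /=; have [lt|lt] := leqP q (o h).
  exists q.-1; first by rewrite (leq_trans (leq_pred q)).
  rewrite oq negbK prednK // lt ltn_eqF ?prednK //; split=> //.
  by case: (odd q.-1) => /=; rewrite addn1 prednK.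
exists q => //; rewrite ltnNge (ltnW lt) gtn_eqF //; split=> //.
by case: (odd q); rewrite /= addn0.
Qed.

Lemma free_hole N (s : seq nat) : size s < N -> exists2 h, h < N & h \notin s.
Proof.
move=> sN; apply: NNPP => H; have /(uniq_leq_size (iota_uniq 0 N)) : {subset iota 0 N <= s}.
  move=> h; rewrite mem_iota => /= hN; apply: contraT => hs; case: H; exists h => //.
by rewrite size_iota leqNgt sN.
Qed.

(** The current state answers every block except possibly a pigeon connector. *)
Lemma extend_state N k D S f : k < N -> kset l k D S -> valid N f -> state_set N S ->
  exists c, [/\ valid N c, block c = block f & state_set N (fact c :: S)].
Proof.
move=> kN [_ [szS _]] vf [o [oN oinj H]].
have ext o' c : (forall h, h < N -> o' h <= N) ->
    (forall h h', h < N -> h' < N -> o' h = o' h' -> h = h') ->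
    (forall x, x \in S -> exists c, [/\ valid N c, chosen o' c & x = fact c]) ->
    valid N c -> chosen o' c -> state_set N (fact c :: S).
  move=> H1 H2 H3 vc oc; exists o'; split=> // x; rewrite inE => /predU1P[->|/H3] //.
  by exists c.
case: f vf => [[[[lev star] i] t] j] vf; have /and5P[ok t3 l3 jT Hf] := vf.
have [/andP[/eqP el /eqP ej]|notend] := boolP ((lev == 1) && (j.+1 == T)); last first.
  exists (lev, serves o i != t, i, t, j).
  have vc : valid N (lev, serves o i != t, i, t, j).
    rewrite /valid ok t3 l3 jT; case: lev l3 {vf} Hf notend => [|[|lev]] //= _ Hf.
    move=> /negbTE je; case: (_ != _); rewrite ?je // ltn_neqAle je //.
  by split=> //; apply: (ext o) => //=.
subst lev; have {ej}ej : j = T.-1 by rewrite -ej.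
subst j; case: star Hf vf => [Hf|/implyP Hf] vf; first by move: Hf; rewrite prednK // ltnn.
have {}Hf : attached N i t by apply: Hf; rewrite prednK.
have vc i' : okhub N i' -> attached N i' t -> valid N (1, false, i', t, T.-1).
  by move=> ok' at'; rewrite /valid ok' t3 jT at' implybT.
case: i ok Hf vf => h p ok at_hp vf; have /andP[/= hN pN] := ok.
case: (posnP t) => [t0|t0]; last first.
  have [|q qN [cq sq]] := @link_server N o (h, p) t _ ok at_hp; first by rewrite t0.
  have vq : valid N (1, false, (h, q), t, T.-1).
    apply: vc; first by rewrite /okhub /= hN.
    by case: t cq at_hp {t3 vf sq t0} => //= t' ->.
  exists (1, false, (h, q), t, T.-1); split=> //.
    apply: (block_end false vq cq).
  by apply: (ext o) => //=; rewrite sq eqxx.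
subst t.
have [[h' [h'N oh']]|np] := classic (exists h', h' < N /\ o h' = p).
  have vq : valid N (1, false, (h', p), 0, T.-1) by apply: vc; rewrite // /okhub /= h'N.
  exists (1, false, (h', p), 0, T.-1); split=> //; first by apply: (block_end false vq).
  by apply: (ext o) => //=; rewrite /serves /= oh' eqxx.
have [cs [szc Hcs]] : exists cs : seq code, size cs = size (undup S) /\
    forall x, x \in undup S -> exists2 c, c \in cs & [/\ valid N c, chosen o c & x = fact c].
  by apply: list_choice => x; rewrite mem_undup; apply: H.
(* The unseated pigeon [p] goes to a hole that no chosen code of a fact of [S] mentions; such a hole
   exists since [k < N], and the choices in [S] are unaffected. *)
have [h' h'N h's] : exists2 h', h' < N & h' \notin [seq c.1.1.2.1 | c <- cs].
  by apply: free_hole; rewrite size_map szc (leq_ltn_trans szS).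
have vq : valid N (1, false, (h', p), 0, T.-1) by apply: vc; rewrite // /okhub /= h'N.
exists (1, false, (h', p), 0, T.-1); split=> //; first by apply: (block_end false vq).
apply: (ext (fun x => if x == h' then p else o x)) => //=.
- by move=> x xN; case: ifP => // _; apply: oN.
- move=> x x' xN x'N; case: eqP => [->|_]; case: eqP => [->|_] // e.
  + by case: np; exists x'.
  + by case: np; exists x.
  + exact: oinj.
- move=> x; rewrite -mem_undup => /Hcs[c ccs [vc' oc ->]]; exists c; split=> //.
  have : c.1.1.2.1 != h' by apply: contraNneq h's => <-; apply: (map_f (fun c : code => c.1.1.2.1)).
  by case: c oc {ccs vc'} => [[[[lev star] i] t] j] /=; rewrite /serves => oc /negbTE ->.
by rewrite /serves /= eqxx eqxx.
Qed.

(** By induction no state set enters the fixpoint, while the empty set is one, with the identity as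
    state. *)
Lemma not_Cert_db N k : k < N -> ~ Cert l A B k (db N).
Proof.
move=> kN C.
suff H S : Delta l A B k (db N) S -> ~ state_set N S.
  by apply: (H _ C); exists id; split=> // h /ltnW.
elim/Delta_ind_nested: _ / => {}S => [_ sat /state_set_unsat //|f kS /dbP[c vc ->] H st].
have [c' [vc' ec st']] := extend_state kN kS vc st.
have [||S' [sub]] := H (fact c'); first exact: valid_fact.
  by rewrite /key_eq (key_fact vc') (key_fact vc) ec.
by case: st' => o [o1 o2 o3]; case; exists o; split=> // x /sub; apply: o3.
Qed.

Lemma gadget_separates k : exists D, ~ (certain l A B D <-> Cert l A B k D).
Proof.
exists (db k.+1) => -[/(_ (certain_db (ltn0Sn k))) C _].
exact: (not_Cert_db (ltnSn k) C).
Qed.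

End Gadget.

(** * From the triangle to the gadget *)

Lemma classic_min (P : nat -> Prop) : (exists m, P m) ->
  exists m, P m /\ forall m', m' < m -> ~ P m'.
Proof.
case=> m; elim/ltn_ind: m => m IH Pm.
have [[m' [m'm Pm']]|H] := classic (exists m', m' < m /\ P m'); first exact: (IH m').
by exists m; split=> // m' m'm Pm'; apply: H; exists m'.
Qed.

Lemma filter_iota_only (P : pred nat) r : (forall t, t < 3 -> P t -> t = r) ->
  [seq t <- iota 0 3 | P t] = [::] \/ [seq t <- iota 0 3 | P t] = [:: r].
Proof.
move=> H; rewrite /=; case p0: (P 0); case p1: (P 1); case p2: (P 2); auto.
all: try by have := H 0 isT p0; have := H 1 isT p1; lia.
all: try by have := H 0 isT p0; have := H 2 isT p2; lia.
all: try by have := H 1 isT p1; have := H 2 isT p2; lia.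
all: right; congr [:: _]; exact: H.
Qed.

(** * Shortest runs of marks *)

Section Bits.
Variables (n l : nat) (A B : n.-tuple nat).
Hypothesis ln : l <= n.
Notation alpha := (keyt l A).
Notation beta := (keyt l B).
Variable w : nat -> bool.
Hypothesis wE : forall p, p < l -> w (nth 0 B p) = w (nth 0 A p).
Hypothesis w_alpha : exists2 v, v \in alpha & w v.

(** A run carries the marks [w] along the links until no variable common to both keys is marked. *)
Definition loss_run (m : nat) (Y : nat -> nat -> bool) : Prop :=
  [/\ forall v, v \in alpha -> Y 0 v = w v,
      forall j p, j < m -> p < l -> Y j (nth 0 B p) = Y j.+1 (nth 0 A p) &
      forall v, v \in alpha -> v \in beta -> Y m v = false].

Lemma minimal_loss_run : (exists m Y, loss_run m Y) -> exists m Y,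
  [/\ [/\ loss_run m Y,
      forall j j', j <= m -> j' <= m -> map (Y j) alpha = map (Y j') alpha -> j = j' &
      forall j, j <= m -> exists2 v, v \in alpha & Y j v],
      0 < m -> exists p, [/\ p < l, nth 0 A p \in beta & nth 0 B p \notin alpha] &
      0 < m -> exists p, [/\ p < l, nth 0 B p \in alpha & nth 0 A p \notin beta]].
Proof.
move=> /classic_min[m [[Y run] min]]; exists m, Y.
have [start step last] := run.
have short j : j < m -> exists v, [/\ v \in alpha, v \in beta & Y j v].
  move=> jm; apply: NNPP => H; apply: (min j jm); exists Y; split=> //.
  - by move=> i p ij; apply: step; apply: ltn_trans jm.
  - by move=> v va vb; apply/negP => Yv; apply: H; exists v.
have mA p : p < l -> nth 0 A p \in alpha.
  by move=> pl; rewrite mem_keyt // (leq_trans pl).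
have mB p : p < l -> nth 0 B p \in beta.
  by move=> pl; rewrite mem_keyt // (leq_trans pl).
split; [split=> //| |].
- suff H j j' : j < j' -> j' <= m -> map (Y j) alpha <> map (Y j') alpha.
    move=> j j' jm j'm e; case: (ltngtP j j') => // lt; first by case: (H _ _ lt j'm).
    by case: (H _ _ lt jm).
  (* A repeated marking allows the levels between [j] and [j'] to be cut out. *)
  move=> jj' j'm /eq_in_map e; apply: (min (m - (j' - j))); first by lia.
  exists (fun s => Y (if s < j then s else s + (j' - j))); split.
  + move=> v va; rewrite -start //; case: ifP => // j0.
    have -> : 0 + (j' - j) = j' by lia.
    by rewrite -e //; have -> : j = 0 by lia.
  + move=> s p sm pl; case: (ltngtP s.+1 j) => [lt|gt|ej].
    * by apply: step => //; lia.
    * by rewrite addSn; apply: step => //; lia.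
    * rewrite step //; last by lia.
      by rewrite ej e ?mA //; congr (Y _ _); lia.
  + move=> v va vb; have -> : (m - (j' - j) < j) = false by lia.
    by rewrite subnK ?last //; lia.
- case=> [|j] jm; first by have [v va wv] := w_alpha; exists v => //; rewrite start.
  have [v [_ vb Yv]] := short j jm; have [p [pl _ ev]] := keytP ln vb.
  by exists (nth 0 A p); rewrite ?mA // -step // -ev.
(* Otherwise the shared variables keep the value [w] up to level [m], although one is marked at
   level 0. *)
- move=> m0; apply: NNPP => H.
  have {}H p : p < l -> nth 0 A p \in beta -> nth 0 B p \in alpha.
    by move=> pl Ab; apply: contraT => Ba; case: H; exists p.
  have Yw s : s <= m -> forall v, v \in alpha -> v \in beta -> Y s v = w v.
    elim: s => [|s IH] sm v va vb; first exact: start.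
    have [p [pl _ ev]] := keytP ln va; rewrite ev -step // IH ?wE ?H ?mB //; first exact: ltnW.
    by rewrite -ev.
  have [v [va vb]] := short 0 m0.
  by rewrite (Yw _ (ltnW m0)) // -(Yw m) // last.
(* Otherwise a marked shared variable hands its mark to a shared variable of the next level, up to
   level [m]. *)
- move=> m0; apply: NNPP => H.
  have {}H p : p < l -> nth 0 B p \in alpha -> nth 0 A p \in beta.
    by move=> pl Ab; apply: contraT => Ba; case: H; exists p.
  have Y1 s : s <= m -> exists v, [/\ v \in alpha, v \in beta & Y s v].
    elim: s => [|s IH] sm; first exact: short.
    have [v [va vb Yv]] := IH (ltnW sm); have [p [pl _ ev]] := keytP ln vb.
    by exists (nth 0 A p); rewrite mA // H -?ev //; split=> //; rewrite -step // -ev.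
  by have [v [va vb]] := Y1 m (leqnn m); rewrite last.
Qed.

End Bits.

Lemma mod3_trichotomy t t' :
  [\/ t = t' %[mod 3], t = t'.+1 %[mod 3] | t = t'.+2 %[mod 3]].
Proof.
have [|[|]] : t = t' %[mod 3] \/ t = t'.+1 %[mod 3] \/ t = t'.+2 %[mod 3] by lia.
- by constructor 1.
- by constructor 2.
- by constructor 3.
Qed.

Lemma eqmod3S t t' : t = t' %[mod 3] -> t.+1 = t'.+1 %[mod 3].
Proof. by lia. Qed.

(** * Incomparable keys, or keys with equal element sets *)

Section Triangle.
Variables (n l : nat) (A B : n.-tuple nat).
Hypothesis ln : l <= n.
Hypothesis AB2 : twoway l A B.
Notation alpha := (keyt l A).
Notation beta := (keyt l B).
Variables h0 h1 h2 : n.-tuple nat.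
Hypothesis q01 : qmatch A B h0 h1.
Hypothesis q12 : qmatch A B h1 h2.
Hypothesis q20 : qmatch A B h2 h0.
Hypothesis h01 : keyt l h0 <> keyt l h1.
Hypothesis h12 : keyt l h1 <> keyt l h2.
Hypothesis h20 : keyt l h2 <> keyt l h0.
Hypothesis loss : ksub (keyt l h0) (keyt l h1) -> ksub (keyt l h1) (keyt l h2) ->
  ksub (keyt l h2) (keyt l h0) ->
  exists (g : nat) (k : seq nat), [/\ g \in keyt l h1, g \notin k & key_path l A B (keyt l h1) k].
Hypothesis fresh_up : exists p, [/\ p < n, nth 0 B p \in alpha ++ beta &
  nth 0 A p \notin alpha].

Lemma triangle_run : exists mu : nat -> nat -> nat,
  [/\ forall s v, mu s.+3 v = mu s v, forall s, map (mu s) B = map (mu s.+1) A &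
      [/\ keyt l h0 = map (mu 0) alpha, keyt l h1 = map (mu 1) alpha &
          keyt l h2 = map (mu 2) alpha]].
Proof.
case: q01 q12 q20 => [f0 [A0 B0]] [f1 [A1 B1]] [f2 [A2 B2]].
exists (fun s => match s %% 3 with 0 => f0 | 1 => f1 | _ => f2 end); split.
- by move=> s v; rewrite -addn3 modnDr.
- move=> s; have -> : s.+1 %% 3 = (s %% 3).+1 %% 3 by lia.
  have := ltn_pmod s (isT : 0 < 3).
  by case: (s %% 3) => [|[|[|]]] //= _; congruence.
- by split; apply: keyt_map.
Qed.

Theorem triangle_separates k : exists D, ~ (certain l A B D <-> Cert l A B k D).
Proof.
have [nAB [nBA [AsB BsA]]] := AB2.
have [mu [mu3 muE [k0 k1 k2]]] := triangle_run.
have muS := mu_step ln muE; have mu_eqm := mu_eqmod mu3.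
have mu_key s s' : map (mu s) alpha = map (mu s') alpha -> s = s' %[mod 3].
  have mm t : map (mu t) alpha = map (mu (t %% 3)) alpha.
    by apply: eq_map => v; apply: mu_eqm; rewrite modn_mod.
  rewrite (mm s) (mm s'); move: (ltn_pmod s (isT : 0 < 3)) (ltn_pmod s' (isT : 0 < 3)).
  by case: (s %% 3) => [|[|[|]]] //; case: (s' %% 3) => [|[|[|]]] // _ _; congruence.
(* In the product with the rotations, permuting coordinates carries key [s] to key [s.+1], so any
   inclusion between two keys can be rotated. *)
pose eta s v := (mu s v, mu s.+1 v, mu s.+2 v).
have eta3 s v : eta s.+3 v = eta s v by rewrite /eta !mu3.
have etaE s : map (eta s) B = map (eta s.+1) A.
  apply: (@eq_from_nth _ (0, 0, 0)) => [|p]; rewrite !size_map !size_tuple // => pn.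
  rewrite !(nth_map 0) ?size_tuple // /eta.
  by rewrite !(eq_map_nth (muE _) pn).
have eta_inj s s' : map (eta s) alpha = map (eta s') alpha -> s = s' %[mod 3].
  by move=> /eq_in_map e; apply: mu_key; apply/eq_in_map => v /e[].
pose rot (x : nat * nat * nat) := (x.1.2, x.2, x.1.1).
have eta_rot s v : eta s.+1 v = rot (eta s v) by rewrite /eta /rot mu3.
have key_rot s : map (eta s.+1) alpha = map rot (map (eta s) alpha).
  by rewrite -map_comp; apply: eq_map => v; rewrite eta_rot.
have eta_eqm s s' : s = s' %[mod 3] -> eta s =1 eta s'.
  move=> e v; rewrite /eta; congr (_, _, _); apply: mu_eqm; lia.
have key_eqm s s' : s = s' %[mod 3] -> map (eta s) alpha = map (eta s') alpha.
  by move=> /eta_eqm e; apply: eq_map.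
have etab s v : v \in beta -> eta s v \in map (eta s.+1) alpha.
  move=> /(keytP ln)[p [pl pn ->]]; rewrite (eq_map_nth (etaE s) pn).
  by apply: map_f; rewrite mem_keyt.
pose incl s s' := {subset map (eta s) alpha <= map (eta s') alpha}.
have incl_rot s s' d : incl s s' -> incl (d + s) (d + s').
  move=> H; elim: d => // d IH x; rewrite !addSn !key_rot => /mapP[y /IH ys ->].
  exact: map_f.
have [eq01|ne01] := classic (incl 0 1); last first.
  have nincl1 s : exists2 v, v \in alpha & eta s v \notin map (eta s.+1) alpha.
    apply: NNPP => H; apply: ne01; have Hs : incl s s.+1.
      by move=> x /mapP[v va ->]; apply: contraT => nv; case: H; exists v.
    have := incl_rot _ _ (2 * s) Hs; rewrite /incl.
    by rewrite (@key_eqm _ 0) ?(@key_eqm (2 * s + s.+1) 1) //; lia.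
  have nincl2 s : exists2 v, v \in alpha & eta s v \notin map (eta s.+2) alpha.
    apply: NNPP => H; apply: ne01; have Hs : incl s s.+2.
      by move=> x /mapP[v va ->]; apply: contraT => nv; case: H; exists v.
    have := incl_rot _ _ (2 * s) Hs; have := incl_rot _ _ (2 * s).+2 Hs; rewrite /incl.
    rewrite (@key_eqm ((2 * s).+2 + s) 2) ?(@key_eqm ((2 * s).+2 + s.+2) 1) //; try lia.
    rewrite (@key_eqm (2 * s + s) 0) ?(@key_eqm (2 * s + s.+2) 2) //; try lia.
    by move=> H2 H1 x /H1 /H2.
  pose Y0 (j v : nat) := false.
  apply: (@gadget_separates n l A B ln AsB BsA nBA nAB eta (fun=> false) 1 Y0) => //.
  - by move=> [] // [].
  (* An element in the end of leg [t'] lies in the keys [t'] and [t'.+1]. Missing key [t.+2] leaves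
     only leg [t], missing key [t.+1] only leg [t.+2], modulo 3. *)
  - move=> t [|//] _; rewrite addn0 /ends /Y0.
    have [v1 va1 nv1] := nincl2 t; have [v2 va2 nv2] := nincl1 t.
    have only1 t' : t' < 3 -> in_end l A B eta 1 Y0 t' (eta t v1, false) -> t' = t %% 3.
      move=> t3 /mapP[u]; rewrite mem_filter addn0 => /andP[ub ua] /(congr1 fst) e0.
      have {e0}e : eta t v1 = eta t' u := e0.
      have [e1|e1|e1] := mod3_trichotomy t' t.
      - by rewrite -e1 modn_small.
      - by move: nv1; rewrite e -(key_eqm _ _ (eqmod3S e1)) etab.
      - by move: nv1; rewrite e -(key_eqm _ _ e1) map_f.
    have only2 t' : t' < 3 -> in_end l A B eta 1 Y0 t' (eta t v2, false) -> t' = t.+2 %% 3.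
      move=> t3 /mapP[u]; rewrite mem_filter addn0 => /andP[ub ua] /(congr1 fst) e0.
      have {e0}e : eta t v2 = eta t' u := e0.
      have [e1|e1|e1] := mod3_trichotomy t' t.
      - by move: nv2; rewrite e -(key_eqm _ _ (eqmod3S e1)) etab.
      - by move: nv2; rewrite e -(key_eqm _ _ e1) map_f.
      - by rewrite -e1 modn_small.
    have [e1|e1] := filter_iota_only only1; first by left; exists v1.
    have [e2|e2] := filter_iota_only only2; first by left; exists v2.
    right; exists v1, v2, (t %% 3), (t.+2 %% 3); split=> //; apply/eqP => /esym; clear; lia.
have sub s s' : incl s s' -> ksub (map (mu s) alpha) (map (mu s') alpha).
  move=> H; apply/allP => x /mapP[v va ->].
  have /H/mapP[u ua] : eta s v \in map (eta s) alpha by apply: map_f.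
  by case=> -> _ _; apply: map_f.
have incl12 : incl 1 2 by apply: (incl_rot 0 1 1).
have incl20 : incl 2 0.
  by move: (incl_rot 0 1 2 eq01); rewrite /incl (@key_eqm (2 + 1) 0).
have [] := loss; rewrite ?k0 ?k1 ?k2; try exact: sub.
move=> g [k' [gk1 gk' path]].
(* The mark asks for [g] in any coordinate of the triple, which rotation does not affect. *)
pose w v := [|| mu 0 v == g, mu 1 v == g | mu 2 v == g].
pose om (x : nat * nat * nat) := [|| x.1.1 == g, x.1.2 == g | x.2 == g].
have omE s v : om (eta s v) = w v.
  have om_rot x : om (rot x) = om x.
    by rewrite /om /rot /= [RHS]orbC orbA.
  by elim: s => // s; rewrite eta_rot om_rot.
have wE p : p < l -> w (nth 0 B p) = w (nth 0 A p).
  move=> pl; rewrite -(omE 0) -(omE 1); congr om.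
  exact: (eq_map_nth (etaE 0) (leq_trans pl ln)).
have w1 : exists2 v, v \in alpha & w v.
  by move: gk1 => /mapP[v va ev]; exists v; rewrite // /w -ev eqxx orbT.
(* One loss for each phase; the disjunction of the three starts from [w]. *)
have [Ya [a0 aS [Na aN]]] := directed_loss ln mu3 muE 0 path gk'.
have [Yb [b0 bS [Nb bN]]] := directed_loss ln mu3 muE 1 path gk'.
have [Yc [c0 cS [Nc cN]]] := directed_loss ln mu3 muE 2 path gk'.
have run : exists m Y, loss_run l A B w m Y.
  exists (Na + Nb + Nc), (fun s v => [|| Ya s v, Yb s v | Yc s v]); split.
  - by move=> v /(keytP ln)[p [pl _ ->]]; rewrite a0 // b0 // c0.
  - by move=> j p _ pl; rewrite aS // bS // cS.
  - move=> v _ _; rewrite aN ?bN ?cN //; first by rewrite leq_addl.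
      by rewrite addnAC leq_addl.
    by rewrite -addnA leq_addr.
have [m [Y [[run_mY Yinj Ynz] up down]]] := minimal_loss_run ln wE w1 run.
have [Y0 YS Ym] := run_mY.
apply: (@gadget_separates n l A B ln AsB BsA nBA nAB eta om m.+1 Y) => //.
- by move=> s v va; rewrite omE Y0.
- move=> j jm; apply: (@eq_from_nth _ false) => [|p]; rewrite !size_map !size_takel ?size_tuple //.
  by move=> pl; rewrite !(nth_map 0) ?size_takel ?size_tuple // !nth_take // YS.
(* A marked element lies in no connector, since the shared variables of the last level are
   unmarked. *)
- move=> t j jm; left; have [v va Yv] := Ynz j jm; exists v => //.
  rewrite /ends (eq_filter (a2 := pred0)) ?filter_pred0 // => t'.
  apply/negbTE/mapP => -[u]; rewrite mem_filter => /andP[ub ua] /(congr1 snd) /=.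
  by rewrite Yv Ym.
Qed.
End Triangle.

(** * The theorem *)

Lemma twoway_sym n l (A B : n.-tuple nat) : twoway l A B -> twoway l B A.
Proof. by move=> [? [? []]]. Qed.

Lemma key_path_sym n l (A B : n.-tuple nat) k1 k2 :
  key_path l A B k1 k2 -> key_path l B A k1 k2.
Proof.
elim=> [k|{}k1 k k3 H _ IH]; first exact: KeyPathRefl.
apply: KeyPathStep IH; case: H => -[f [-> ->]]; [right|left]; by exists f.
Qed.

Lemma qmatch_key_link n l (A B x y : n.-tuple nat) :
  qmatch A B x y -> key_link l A B (keyt l x) (keyt l y).
Proof. by case=> f [ex ey]; exists f; rewrite (keyt_map l ex) (keyt_map l ey). Qed.

(** Take a position where [B] has a key variable of [A] outside its own key: it serves [A], [B] or
    the exchanged atoms, according to whether the variable of [A] there is outside the key of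
    [A]. *)
Lemma fresh_up_either n l (A B : n.-tuple nat) : twoway l A B ->
  (exists p, [/\ p < n, nth 0 B p \in keyt l A ++ keyt l B & nth 0 A p \notin keyt l A]) \/
  (exists p, [/\ p < n, nth 0 A p \in keyt l B ++ keyt l A & nth 0 B p \notin keyt l B]).
Proof.
move=> [/allPn[v va vb] [_ [/allP AB _]]]; apply: NNPP => H.
have /(nthP 0)[p] := AB v va; rewrite size_tuple => pn ev.
have Ap : nth 0 A p \in keyt l A.
  apply: contraT => nA; case: H; left; exists p; split=> //.
  by rewrite mem_cat ev va.
case/negP: vb; rewrite -ev; apply: contraT => nB; case: H; right; exists p.
by split=> //; rewrite mem_cat Ap orbT.
Qed.

(** Of the tripath only the triangle and the branch from its centre to the root are kept. *)
Lemma tripath_triangle n l (A B : n.-tuple nat) T : tripath l A B T true ->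
  exists d e f : n.-tuple nat,
  [/\ [/\ qmatch A B d e, qmatch A B e f & qmatch A B f d],
      [/\ keyt l d <> keyt l e, keyt l e <> keyt l f & keyt l f <> keyt l d] &
      exists u : n.-tuple nat, key_path l A B (keyt l e) (keyt l u) /\
        ~~ ksub (gbar l d e f) (keyt l u)].
Proof.
move=> [root [s [a [b [lf1 [lf2]]]]]]; cbv zeta.
move=> [rootK [sK [reach [_ [aroot [bleaf [abin [link]]]]]]]].
set K := [seq keyt l t | t <- T] in rootK sK reach bleaf abin link *.
pose child x y := x \in K /\ x <> root /\ s x = y.
pose leaf y := y \in K /\ forall x, ~ child x y.
move=> [k [k1 [k2 [c1 [c2 [k12 [[_ [_ de]] [[_ [_ ef]] [fd gu]]]]]]]]].
have [_ [_ {}fd]] := fd isT.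
have keya x y : child x y -> keyt l (a y) = y.
  move=> xy; have yK : y \in K by case: xy => xK [xr <-]; apply: sK.
  have [->|/eqP yr] := eqVneq y root; first by case: (aroot (a root)) => _ [].
  have nl : ~ leaf y by case=> _ /(_ x).
  by have [_ /(_ (a y))[_ []]] := abin y yK yr nl; first by left.
have keyb x : x \in K -> x <> root -> keyt l (b x) = x.
  move=> xK xr; have [lx|nl] := classic (leaf x).
    by have [_ []] := bleaf x xK xr lx (b x).
  by have [_ /(_ (b x))[_ []]] := abin x xK xr nl; first by right.
have path m x : x \in K -> iter m s x = root -> key_path l A B x root.
  elim: m x => [|m IH] x xK; first by move=> /= ->; apply: KeyPathRefl.
  rewrite iterSr => e; have [->|/eqP xr] := eqVneq x root; first exact: KeyPathRefl.
  have xsx : child x (s x) by [].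
  apply: KeyPathStep (IH _ (sK x xK xr) e).
  by case: (link _ _ xsx) => -[_ [_ /(@qmatch_key_link n l)]];
     rewrite (keya _ _ xsx) (keyb _ xK xr); [right|left].
have kK : k \in K by case: c1 => k1K [k1r <-]; apply: sK.
have [m em] := reach k kK.
(* A block that is its own parent would never reach the root. *)
have nk x : child x k -> x <> k.
  move=> xk ex; subst x; case: xk => _ [kr sk]; apply: kr; rewrite -em.
  by elim: m {em} => //= m <-.
have [ka kb1 kb2] : [/\ keyt l (a k) = k, keyt l (b k1) = k1 & keyt l (b k2) = k2].
  by split; [apply: keya c1|apply: keyb; case: c1 => ? []|apply: keyb; case: c2 => ? []].
exists (b k1), (a k), (b k2); split=> //.
  by rewrite ka kb1 kb2; split; [apply: nk|apply/nesym; apply: nk|apply/nesym].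
exists (a root); split; last by apply: gu; rewrite mem_head.
have -> : keyt l (a root) = root by case: (aroot (a root)) => _ [].
by rewrite ka; apply: path em.
Qed.

Theorem theorem10p1 (n l : nat) (A B : n.-tuple nat) :
  0 < n -> l <= n ->
  twoway l A B -> standing l A B -> admits_triangle_tripath l A B ->
  forall k : nat, 1 <= k ->
  exists D : seq (n.-tuple nat), ~ (certain l A B D <-> Cert l A B k D).
Proof.
move=> _ ln AB2 _ [_ [T [_ /tripath_triangle]]].
move=> [d [e [f [[de ef fd] [nde nef nfd] [u [path gu]]]]]] k _.
have loss : ksub (keyt l d) (keyt l f) -> ksub (keyt l f) (keyt l e) ->
    ksub (keyt l e) (keyt l d) ->
    exists (g : nat) (kk : seq nat),
      [/\ g \in keyt l e, g \notin kk & key_path l A B (keyt l e) kk].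
  move=> sdf sfe sed; have sde : ksub (keyt l d) (keyt l e).
    by apply/allP => x /(allP sdf) /(allP sfe).
  (* Here [gbar] is the key of [d], so an element of it missing at the root is the one to lose. *)
  move: gu; rewrite /gbar sde sfe sdf /= => /allPn[g gd gu].
  by exists g, (keyt l u); split=> //; apply: (allP sde).
have [fresh|fresh] := fresh_up_either AB2.
  apply: (triangle_separates ln AB2 de ef fd) => // sde sef sfd.
  by apply: loss; apply/allP => x; [move/(allP sde)/(allP sef)|move/(allP sfd)/(allP sde)|move/(allP sef)/(allP sfd)].
have [D HD] : exists D, ~ (certain l B A D <-> Cert l B A k D).
  (* Exchanging the atoms reverses the orientation of the triangle. *)
  apply: (triangle_separates ln (twoway_sym AB2) (qmatch_sym ef) (qmatch_sym de) (qmatch_sym fd)) => //; try exact: nesym.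
  move=> sfe sed sdf; have [g [kk [ge gk P]]] := loss sdf sfe sed.
  by exists g, kk; split=> //; apply: key_path_sym.
exists D => H; apply: HD; split.
- by move=> /certain_sym /H /Cert_sym.
- by move=> /Cert_sym /H /certain_sym.
Qed.
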